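(* Let $d \ge 2$ and let $G \leq \mathrm{Aut}(\mathcal{T}_d)$ be the closure of some finitely generated, contracting regular branch group, branching over a congruence subgroup. Then $\mathrm{AAut}_G(\mathcal{T}_d)$ is a totally disconnected locally compact, compactly presented group.
   Context: $\mathcal{T}_d$ is the rooted $d$-regular tree with vertex set $X^*$ (finite words over an ordered alphabet $X$ with $|X|=d$), $\mathrm{Aut}(\mathcal{T}_d)$ its group of (root-fixing) automorphisms with its profinite topology (pointwise level stabilizers form a basis of neighbourhoods of $1$). For $g\in\mathrm{Aut}(\mathcal{T}_d)$ and a vertex $v$, the section $g_v\in\mathrm{Aut}(\mathcal{T}_d)$ is defined by $g(vw)=g(v)g_v(w)$ for all $w\in X^*$. A subgroup $H\leq\mathrm{Aut}(\mathcal{T}_d)$ is self-similar if every section of every element of $H$ is in $H$. A self-similar group $H$ is contracting if there is a finite subset $\mathcal{N}\subset H$ such that for every $h\in H$ there is $k\geq1$ such that all sections of $h$ at vertices of level at least $k$ belong to $\mathcal{N}$. For $H$ self-similar, let $\psi:H\to H\wr\mathrm{Sym}(d)$ be the injective homomorphism given by the level-one sections and the action on level one. $H$ is regular branch over its finite index subgroup $K$ if $\psi(K)$ contains $K\times\cdots\times K$ ($d$ factors) as a subgroup of finite index; $H$ is a regular branch group if it is self-similar and regular branch over some such $K$. A finite index subgroup of $H$ is a congruence subgroup if it contains the pointwise stabilizer $H_n$ in $H$ of the $n$th level, for some $n$. Being regular branch passes to closures in $\mathrm{Aut}(\mathcal{T}_d)$. A finite subtree $T$ of $\mathcal{T}_d$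 is a rooted complete subtree if it contains the root as a vertex of degree $d$ and every other vertex of $T$ which is not a leaf has degree $d+1$ in $T$. $\mathcal{T}_d\setminus T$ is regarded as the forest of subtrees hanging at the leaves of $T$, each naturally identified with $\mathcal{T}_d$. $\mathrm{AAut}(\mathcal{T}_d)$ is the group of homeomorphisms of $\partial_\infty\mathcal{T}_d$ induced by triples $(\psi,T,T')$ with $T,T'$ finite rooted complete subtrees with the same number of leaves and $\psi:\mathcal{T}_d\setminus T\to\mathcal{T}_d\setminus T'$ a forest isomorphism (mapping components bijectively onto components by tree isomorphisms). For $G$ self-similar, $\mathrm{AAut}_G(\mathcal{T}_d)$ is the subgroup of elements represented by a triple such that $\psi$ acts by an element of $G$ on each component. When $G$ is a closed regular branch group, $\mathrm{AAut}_G(\mathcal{T}_d)$ is endowed with the group topology for which $G$, with its topology induced from $\mathrm{Aut}(\mathcal{T}_d)$, is a compact open subgroup. A locally compact group is compactly presented if it has a compact generating subset $S$ and a presentation, as an abstract group, with generating set $S$ and relators of bounded length. *)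

(* Defs.v *)
From HB Require Import structures.
From mathcomp Require Import all_boot all_classical.
From mathcomp Require Import topology zify.

Set Implicit Arguments.
Unset Strict Implicit.
Unset Printing Implicit Defensive.

Local Open Scope classical_set_scope.
Local Open Scope group_scope.

Definition subgroup (A : groupType) (H : set A) : Prop :=
  H 1 /\ forall x y, H x -> H y -> H (x / y).

Definition generated (A : groupType) (S : set A) : set A :=
  smallest (@subgroup A) S.

Definition finitely_generated (A : groupType) (H : set A) : Prop :=
  exists2 S : set A, finite_set S & H = generated S.

Definition finite_index (A : groupType) (H K : set A) : Prop :=
  [/\ subgroup K, K `<=` H &
      finite_set [set [set h * k | k in K] | h in H]].

#[short(type="preTopologicalGroupType")]
HB.structure Definition PreTopologicalGroup :=
  {A of Topological A & Group A}.

Definition topological_group (A : preTopologicalGroupType) : Prop :=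
  continuous (fun xy : A * A => xy.1 * xy.2) /\
  continuous (fun x : A => x^-1).

Definition tdlc_group (A : preTopologicalGroupType) : Prop :=
  [/\ topological_group A, hausdorff_space A,
      totally_disconnected [set: A] & locally_compact [set: A]].

(* Bijections act on the left, unlike those of {perm T}: (f * g) x = f (g x). *)

Record permutation (T : Type) := Permutation {
  perm_fun :> T -> T;
  perm_inv : T -> T;
  perm_funK : cancel perm_fun perm_inv;
  perm_invK : cancel perm_inv perm_fun
}.

Section PermutationGroup.
Variable T : Type.
Implicit Types f g h : permutation T.

Lemma permutation_ext f g : f =1 g -> f = g.
Proof.
move=> fg; have invE : perm_inv f = perm_inv g.
  apply/funext => x; apply: (can_inj (perm_funK f)).
  by rewrite perm_invK fg perm_invK.
case: f g fg invE => f f' fK f'K [g g' gK g'K] /= /funext fg f'g'.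
rewrite {}fg {}f'g' in fK f'K *.
by rewrite (Prop_irrelevance fK gK) (Prop_irrelevance f'K g'K).
Qed.

Definition permutation_one : permutation T :=
  @Permutation T id id (fun=> erefl) (fun=> erefl).

Definition permutation_mul f g : permutation T :=
  Permutation (can_comp (perm_funK f) (perm_funK g))
              (can_comp (perm_invK g) (perm_invK f)).

Definition permutation_inv f : permutation T :=
  Permutation (perm_invK f) (perm_funK f).

Let mulA : associative permutation_mul.
Proof. by move=> f g h; apply: permutation_ext. Qed.

Let mul1 : left_id permutation_one permutation_mul.
Proof. by move=> f; apply: permutation_ext. Qed.

Let mulr1 : right_id permutation_one permutation_mul.
Proof. by move=> f; apply: permutation_ext. Qed.

Let mulV : left_inverse permutation_one permutation_inv permutation_mul.
Proof. by move=> f; apply: permutation_ext => x /=; rewrite perm_funK. Qed.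

Let mulVr : right_inverse permutation_one permutation_inv permutation_mul.
Proof. by move=> f; apply: permutation_ext => x /=; rewrite perm_invK. Qed.

HB.instance Definition _ := gen_eqMixin (permutation T).
HB.instance Definition _ := gen_choiceMixin (permutation T).
HB.instance Definition _ :=
  isGroup.Build (permutation T) mulA mul1 mulr1 mulV mulVr.

End PermutationGroup.

Definition word (d : nat) := seq 'I_d.

Definition tree_adj (d : nat) (u v : word d) : Prop :=
  (exists x, v = rcons u x) \/ (exists x, u = rcons v x).

Definition tree_automorphism (d : nat) : pred (permutation (word d)) :=
  fun g => `[< g [::] = [::] /\
               forall u v, tree_adj (g u) (g v) <-> tree_adj u v >].

Record treeAut (d : nat) := TreeAut {
  treeAut_perm :> permutation (word d);
  treeAutP : tree_automorphism treeAut_perm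
}.

Lemma tree_automorphism_group_closed d : group_closed (@tree_automorphism d).
Proof.
split; first by apply/asboolP.
move=> f g /asboolP[f0 fa] /asboolP[g0 ga]; apply/asboolP.
have ginv0 : perm_inv g [::] = [::] by rewrite -[in LHS]g0 perm_funK.
split=> [|u v]; first by rewrite /= ginv0.
by rewrite /= (fa _ _) -(ga _ _) !perm_invK.
Qed.

HB.instance Definition _ d := [isSub for @treeAut_perm d].
HB.instance Definition _ d := [Choice of treeAut d by <:].
HB.instance Definition _ d :=
  SubChoice_isSubGroup.Build (permutation (word d)) (@tree_automorphism d)
    (treeAut d) (@tree_automorphism_group_closed d).

Section TreeAutTheory.
Variable d : nat.
Implicit Types (g h k : treeAut d) (u v w : word d).

Lemma treeAut_ext g h : (forall v, g v = h v) -> g = h.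
Proof. by move=> gh; apply/val_inj/permutation_ext. Qed.

Lemma treeAut1E v : (1 : treeAut d) v = v. Proof. by []. Qed.
Lemma treeAutME g h v : (g * h) v = g (h v). Proof. by []. Qed.
Lemma treeAutVK g v : g^-1 (g v) = v. Proof. exact: perm_funK. Qed.
Lemma treeAutKV g v : g (g^-1 v) = v. Proof. exact: perm_invK. Qed.
Lemma treeAut_inj g : injective g.
Proof. exact: can_inj (treeAutVK g). Qed.

Lemma treeAut0 g : g [::] = [::].
Proof. by have /asboolP[] := treeAutP g. Qed.

Lemma treeAut_rcons g v x : exists y, g (rcons v x) = rcons (g v) y.
Proof.
have adj u y : tree_adj (g u) (g (rcons u y)).
  by have /asboolP[_ ->] := treeAutP g; left; exists y.
elim/last_ind: v x => [|v y IH] x.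
  have [//|[z]] := adj [::] x; rewrite treeAut0 => /(congr1 size).
  by rewrite size_rcons.
have [//|[z]] := adj (rcons v y) x.
have [t gvy] := IH y; rewrite gvy => /rcons_inj[gvx _].
have /(congr1 size) := treeAut_inj gvx.
by rewrite !size_rcons; lia.
Qed.

Lemma treeAut_size g v : size (g v) = size v.
Proof.
elim/last_ind: v => [|v x IH]; first by rewrite treeAut0.
by have [y] := treeAut_rcons g v x; move=> ->; rewrite !size_rcons IH.
Qed.

Lemma treeAut_take g n v : g (take n v) = take n (g v).
Proof.
have [nv|] := leqP n (size v); last first.
  by move=> /ltnW nv; rewrite !take_oversize // treeAut_size.
rewrite -[v in RHS](cat_take_drop n); elim/last_ind: (drop n v) => [|w x IH].
  by rewrite cats0 [RHS]take_oversize // treeAut_size size_takel.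
rewrite -rcons_cat; have [y ->] := treeAut_rcons g (take n v ++ w) x.
by rewrite -cats1 takel_cat // treeAut_size size_cat size_takel // leq_addr.
Qed.

Lemma treeAut_cat g v w : g (v ++ w) = g v ++ drop (size v) (g (v ++ w)).
Proof.
by rewrite -[LHS](cat_take_drop (size v)) -treeAut_take take_size_cat.
Qed.

Definition section_fun g v w := drop (size v) (g (v ++ w)).

Let section_funK g v :
  cancel (section_fun g v) (section_fun g^-1 (g v)).
Proof.
move=> w; rewrite /section_fun -treeAut_cat treeAutVK treeAut_size.
by rewrite drop_size_cat.
Qed.

Let section_invK g v :
  cancel (section_fun g^-1 (g v)) (section_fun g v).
Proof.
by have := @section_funK g^-1 (g v); rewrite invgK treeAutVK.
Qed.

Definition section_perm g v := Permutation (section_funK g v) (section_invK g v).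

Let section_tree_automorphism g v : tree_automorphism (section_perm g v).
Proof.
apply/asboolP; split=> [|u w] /=.
  by rewrite /section_fun cats0 drop_oversize // treeAut_size.
have /asboolP[_ ga] := treeAutP g.
have adj_cat p a b : @tree_adj d (p ++ a) (p ++ b) <-> tree_adj a b.
  split=> -[] [x E]; [left|right|left|right]; exists x.
  1,2: by move: E; rewrite rcons_cat => /eqP; rewrite eqseq_cat // eqxx => /eqP.
  1,2: by rewrite E rcons_cat.
rewrite -(adj_cat (g v)) /section_fun -!treeAut_cat.
by rewrite (ga _ _) adj_cat.
Qed.

(* The section g_v, determined by g (v ++ w) = g v ++ g_v w. *)
Definition section g v : treeAut d :=
  TreeAut (section_tree_automorphism g v).

Lemma sectionE g v w : section g v w = drop (size v) (g (v ++ w)).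
Proof. by []. Qed.

Lemma section_cat g v w : g (v ++ w) = g v ++ section g v w.
Proof. exact: treeAut_cat. Qed.

Lemma eq_section g v (s : treeAut d) : (forall w, g (v ++ w) = g v ++ s w) -> section g v = s.
Proof.
move=> E; apply: treeAut_ext => w.
by rewrite sectionE E -(treeAut_size g v) drop_size_cat.
Qed.

Lemma section1 v : section 1 v = 1.
Proof. exact: eq_section. Qed.

Lemma section_mul g h v : section (g * h) v = section g (h v) * section h v.
Proof. by apply: eq_section => w; rewrite !treeAutME !section_cat. Qed.

Lemma section_inv g v : section g^-1 v = (section g (g^-1 v))^-1.
Proof.
apply: eq_section => w; apply: (@treeAut_inj g).
by rewrite treeAutKV section_cat treeAutKV treeAutKV.
Qed.

Lemma section_comp g v w : section g (v ++ w) = section (section g v) w.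
Proof. by apply: eq_section => t; rewrite -catA !section_cat catA. Qed.

End TreeAutTheory.

Definition self_similar (d : nat) (H : set (treeAut d)) : Prop :=
  forall g v, H g -> H (section g v).

Definition level_stab (d n : nat) : set (treeAut d) :=
  [set g | forall v : word d, size v = n -> g v = v].

Definition contracting (d : nat) (H : set (treeAut d)) : Prop :=
  exists N : set (treeAut d), [/\ finite_set N, N `<=` H &
    forall h, H h -> exists2 k, (0 < k)%N &
      forall v : word d, (k <= size v)%N -> N (section h v)].

(* The profinite topology, with base the left cosets of level stabilizers *)

Section ProfiniteTopology.
Variable d : nat.
Implicit Types (g h k : treeAut d) (U V : set (treeAut d)).

Lemma level_stab_leq m n : (m <= n)%N -> @level_stab d n `<=` @level_stab d m.
Proof.
move=> mn g gn [|x v] vm; first by rewrite treeAut0.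
have := gn ((x :: v) ++ nseq (n - m) x).
rewrite size_cat size_nseq vm subnKC // => /(_ erefl).
by move=> /(congr1 (take m)); rewrite -treeAut_take take_size_cat.
Qed.

Lemma level_stab_eq n g h :
  level_stab n (g^-1 * h) <-> forall v, size v = n -> h v = g v.
Proof.
split=> E v /E; rewrite treeAutME; last by move=> ->; rewrite treeAutVK.
by move=> {2}<-; rewrite treeAutKV.
Qed.

Lemma level_stabM n g h : level_stab n g -> level_stab n h ->
  level_stab n (g * h).
Proof. by move=> gn hn v vn; rewrite treeAutME hn // gn. Qed.

Definition treeAut_open U : Prop :=
  forall g, U g -> exists n, forall h, level_stab n h -> U (g * h).

Let openT : treeAut_open setT.
Proof. by move=> g _; exists 0. Qed.

Let openI : setI_closed treeAut_open.
Proof.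
move=> U V Uo Vo g [/Uo[m Um] /Vo[n Vn]]; exists (maxn m n) => h hmn.
split; [apply: Um|apply: Vn]; apply: level_stab_leq hmn.
  exact: leq_maxl.
exact: leq_maxr.
Qed.

Let open_bigU (I : Type) (f : I -> set (treeAut d)) :
  (forall i, treeAut_open (f i)) -> treeAut_open (\bigcup_i f i).
Proof.
move=> fo g [i _ /fo[n fn]]; exists n => h /fn fgh.
by exists i.
Qed.

HB.instance Definition _ :=
  isOpenTopological.Build (treeAut d) openT openI open_bigU.

Lemma treeAut_nbhsP g U :
  nbhs g U <-> exists n, forall h, level_stab n h -> U (g * h).
Proof.
split=> [[V [Vo Vg VU]]|[n Un]].
  by have [n Vn] := Vo g Vg; exists n => h /Vn/VU.
exists [set g * h | h in level_stab n]; split=> [_ [h hn <-]||_ [h hn <-]].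
- exists n => k kn; exists (h * k); last by rewrite mulgA.
  exact: level_stabM.
- by exists 1 => //; rewrite mulg1.
- exact: Un.
Qed.

Lemma treeAut_closureP U g : closure U g <->
  forall n, exists2 h, U h & forall v, size v = n -> h v = g v.
Proof.
split=> [Ug n|Ug V /treeAut_nbhsP[n Vn]].
  have /Ug[h [Uh [k kn gk]]] : nbhs g [set g * h | h in level_stab n].
    by apply/treeAut_nbhsP; exists n => h hn; exists h.
  by exists h => // v vn; rewrite -gk treeAutME kn.
have [h Uh /level_stab_eq/Vn] := Ug n.
by rewrite mulVKg => Vh; exists h.
Qed.

Lemma closure_subgroup U : subgroup U -> subgroup (closure U).
Proof.
move=> [U1 UV]; split; first exact: subset_closure.
move=> g h /treeAut_closureP Ug /treeAut_closureP Uh.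
apply/treeAut_closureP => n.
have [g' Ug' gg'] := Ug n; have [h' Uh' hh'] := Uh n.
exists (g' / h'); first exact: UV.
move=> v vn; rewrite !treeAutME gg' ?treeAut_size //; congr (g _).
by rewrite -[v in LHS](treeAutKV h) -hh' ?treeAut_size // treeAutVK.
Qed.

Lemma closure_self_similar U : self_similar U -> self_similar (closure U).
Proof.
move=> Us g v /treeAut_closureP Ug; apply/treeAut_closureP => n.
have [h Uh gh] := Ug (size v + n)%N; exists (section h v); first exact: Us.
by move=> w wn; rewrite !sectionE gh // size_cat wn.
Qed.

End ProfiniteTopology.

Record selfSimilarGroup (d : nat) := SelfSimilarGroup {
  ssgroup_set :> set (treeAut d);
  ssgroup_subgroup : subgroup ssgroup_set;
  ssgroup_self_similar : self_similar ssgroup_set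
}.

Definition closure_group (d : nat) (H : selfSimilarGroup d) :
    selfSimilarGroup d :=
  SelfSimilarGroup (closure_subgroup (ssgroup_subgroup H))
                   (closure_self_similar (@ssgroup_self_similar d H)).

(* The wreath product A wr Sym(d) = A^d x| Sym(d), with the multiplication
   for which g |-> ((g_x)_x, action of g on level one) is multiplicative *)

Definition wreath (A : Type) (d : nat) : Type :=
  (('I_d -> A) * permutation 'I_d)%type.

Section WreathGroup.
Variables (A : groupType) (d : nat).
Implicit Types a b c : wreath A d.

Definition wreath_one : wreath A d := (fun=> 1, 1).
Definition wreath_mul a b : wreath A d :=
  (fun x => a.1 (b.2 x) * b.1 x, a.2 * b.2).
Definition wreath_inv a : wreath A d :=
  (fun x => (a.1 (a.2^-1 x))^-1, a.2^-1).

Let mulA : associative wreath_mul.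
Proof.
move=> a b c; congr pair; last by rewrite /= mulgA.
by apply/funext => x /=; rewrite mulgA.
Qed.

Let mul1 : left_id wreath_one wreath_mul.
Proof.
move=> [a s]; congr pair; last by rewrite /= mul1g.
by apply/funext => x /=; rewrite mul1g.
Qed.

Let mulr1 : right_id wreath_one wreath_mul.
Proof.
move=> [a s]; congr pair; last by rewrite /= mulg1.
by apply/funext => x /=; rewrite mulg1.
Qed.

Let mulV : left_inverse wreath_one wreath_inv wreath_mul.
Proof.
move=> a; congr pair; last by rewrite /= mulVg.
by apply/funext => x /=; rewrite perm_funK mulVg.
Qed.

Let mulVr : right_inverse wreath_one wreath_inv wreath_mul.
Proof.
move=> a; congr pair; last by rewrite /= mulgV.
by apply/funext => x /=; rewrite mulgV.
Qed.

HB.instance Definition _ := gen_eqMixin (wreath A d).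
HB.instance Definition _ := gen_choiceMixin (wreath A d).
HB.instance Definition _ :=
  isGroup.Build (wreath A d) mulA mul1 mulr1 mulV mulVr.

End WreathGroup.

Section WreathRecursion.
Variable d : nat.
Implicit Types (g h : treeAut d) (H K : set (treeAut d)).

Definition level1_fun g (x : 'I_d) : 'I_d := head x (g [:: x]).

Let level1_funE g x : g [:: x] = [:: level1_fun g x].
Proof.
by rewrite /level1_fun; have := treeAut_size g [:: x]; case: (g _) => [|y [|]].
Qed.

Let level1_funK g : cancel (level1_fun g) (level1_fun g^-1).
Proof.
by move=> x; rewrite {1}/level1_fun -level1_funE treeAutVK.
Qed.

Let level1_invK g : cancel (level1_fun g^-1) (level1_fun g).
Proof. by have := @level1_funK g^-1; rewrite invgK. Qed.

Definition level1 g : permutation 'I_d :=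
  Permutation (level1_funK g) (level1_invK g).

Lemma level1E g x : g [:: x] = [:: level1 g x].
Proof. exact: level1_funE. Qed.

Definition psi g : wreath (treeAut d) d :=
  (fun x => section g [:: x], level1 g).

Lemma psiM g h : psi (g * h) = psi g * psi h.
Proof.
congr pair; first by apply/funext => x; rewrite section_mul level1E.
apply: permutation_ext => x.
suff [] : [:: level1 (g * h) x] = [:: level1 g (level1 h x)] by [].
by rewrite -level1E treeAutME !level1E.
Qed.

Lemma psi_inj : injective psi.
Proof.
move=> g h E; have E1 := congr1 fst E; have E2 := congr1 snd E.
apply: treeAut_ext => -[|x w]; first by rewrite !treeAut0.
have E1x : section g [:: x] = section h [:: x] := congr1 (@^~ x) E1.
have E2x : level1 g x = level1 h x := congr1 (fun f : permutation _ => f x) E2.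
by rewrite -cat1s !section_cat !level1E E1x E2x.
Qed.

Definition base_power K : set (wreath (treeAut d) d) :=
  [set a | (forall x, K (a.1 x)) /\ a.2 = 1].

Definition regular_branch_over H K : Prop :=
  finite_index H K /\ finite_index (psi @` K) (base_power K).

Definition congruence_subgroup H K : Prop :=
  finite_index H K /\ exists n, H `&` level_stab n `<=` K.

End WreathRecursion.
Definition boundary (d : nat) := nat -> 'I_d.

Section Boundary.
Variable d : nat.
Implicit Types (g h : treeAut d) (u v w : word d) (xi zeta : boundary d).

Definition bcat v xi : boundary d := fun n => nth (xi (n - size v)) v n.

Definition boundary_fun g xi : boundary d :=
  fun n => nth (xi n) (g (mkseq xi n.+1)) n.

Lemma take_mkseq_leq (xi : boundary d) m n :
  (m <= n)%N -> take m (mkseq xi n) = mkseq xi m.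
Proof. by move=> mn; rewrite /mkseq -map_take take_iota (minn_idPl mn). Qed.

Lemma boundary_ext k xi zeta :
  (forall n, mkseq xi (k + n) = mkseq zeta (k + n)) -> xi = zeta.
Proof.
move=> E; apply/funext => i; have := congr1 (fun s => nth (xi i) s i) (E i.+1).
by rewrite !nth_mkseq ?addnS ?ltnS ?leq_addl.
Qed.

Lemma mkseq_bcat v xi n : mkseq (bcat v xi) (size v + n) = v ++ mkseq xi n.
Proof.
apply: (@eq_from_nth _ (xi 0)); rewrite size_mkseq ?size_cat ?size_mkseq//.
move=> i ilt; rewrite nth_mkseq // nth_cat /bcat.
have [iv|iv] := ltnP i (size v); first exact: set_nth_default.
by rewrite nth_default // nth_mkseq //; lia.
Qed.

Lemma bcat0 xi : bcat [::] xi = xi.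
Proof. by apply/funext => n; rewrite /bcat nth_nil subn0. Qed.

Lemma bcat_cat u v xi : bcat (u ++ v) xi = bcat u (bcat v xi).
Proof.
apply: (@boundary_ext (size u + size v)) => n.
by rewrite -{1}size_cat -!addnA !mkseq_bcat catA.
Qed.

Lemma bcat_split n xi : xi = bcat (mkseq xi n) (fun i => xi (n + i)%N).
Proof.
apply: (@boundary_ext n) => m.
rewrite -{4}(size_mkseq xi n) mkseq_bcat /mkseq iotaD map_cat add0n.
by congr cat; rewrite -{1}[n]addn0 iotaDl -map_comp.
Qed.

Lemma bcat_take u v xi zeta : bcat u xi = bcat v zeta ->
  (size u <= size v)%N -> u = take (size u) v.
Proof.
move=> E uv.
have eqv w rho : mkseq (bcat w rho) (size w) = w.
  by have := mkseq_bcat w rho 0; rewrite addn0 cats0.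
by rewrite -(eqv v zeta) take_mkseq_leq // -E eqv.
Qed.

Lemma bcat_inj v : injective (bcat v).
Proof.
move=> xi zeta E; apply: (@boundary_ext 0) => n.
have := congr1 (fun f => mkseq f (size v + n)) E.
by rewrite !mkseq_bcat => /eqP; rewrite eqseq_cat // eqxx => /eqP.
Qed.

Lemma mkseq_boundary_fun g xi n : mkseq (boundary_fun g xi) n = g (mkseq xi n).
Proof.
apply: (@eq_from_nth _ (xi 0)); rewrite size_mkseq ?treeAut_size ?size_mkseq//.
move=> i ilt; rewrite nth_mkseq // /boundary_fun.
rewrite -(take_mkseq_leq xi ilt) treeAut_take nth_take //.
by apply: set_nth_default; rewrite treeAut_size size_mkseq.
Qed.

Lemma boundary_funK g : cancel (boundary_fun g) (boundary_fun g^-1).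
Proof.
move=> xi; apply: (@boundary_ext 0) => n.
by rewrite !mkseq_boundary_fun treeAutVK.
Qed.

Lemma boundary_invK g : cancel (boundary_fun g^-1) (boundary_fun g).
Proof. by have := boundary_funK g^-1; rewrite invgK. Qed.

Definition boundary_act g : permutation (boundary d) :=
  Permutation (boundary_funK g) (boundary_invK g).

Lemma mkseq_boundary_act g xi n : mkseq (boundary_act g xi) n = g (mkseq xi n).
Proof. exact: mkseq_boundary_fun. Qed.

Lemma boundary_actM g h :
  boundary_act (g * h) = boundary_act g * boundary_act h.
Proof.
apply: permutation_ext => xi; apply: (@boundary_ext 0) => n.
by rewrite /= !mkseq_boundary_fun.
Qed.

Lemma boundary_act1 : boundary_act 1 = 1.
Proof.
apply: permutation_ext => xi; apply: (@boundary_ext 0) => n.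
by rewrite mkseq_boundary_act.
Qed.

Lemma boundary_act_inj : injective boundary_act.
Proof.
move=> g h E; apply: treeAut_ext => -[|x v]; first by rewrite !treeAut0.
have := congr1 (fun f : permutation _ =>
  mkseq (f (bcat (x :: v) (fun=> x))) (size (x :: v) + 0)) E.
by rewrite !mkseq_boundary_act mkseq_bcat cats0.
Qed.

Lemma boundary_act_bcat g v xi :
  boundary_act g (bcat v xi) = bcat (g v) (boundary_act (section g v) xi).
Proof.
apply: (@boundary_ext (size v)) => n.
rewrite mkseq_boundary_act -{2}(treeAut_size g v) !mkseq_bcat.
by rewrite mkseq_boundary_act section_cat.
Qed.

End Boundary.

Definition complete_subtree (d : nat) (T : set (word d)) : Prop :=
  [/\ finite_set T,
      T [::] /\ (forall v x, T (rcons v x) -> T v),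
      forall x, T [:: x] &
      forall v x y, T (rcons v x) -> T (rcons v y)].

Definition leaves (d : nat) (T : set (word d)) : set (word d) :=
  [set v | T v /\ forall x, ~ T (rcons v x)].

(* The triple inducing f is (T, T', v ++ w |-> s v ++ phi v w), v a leaf of T.
   Every bijection of the boundary so induced is a homeomorphism. *)
Definition almost_automorphism (d : nat) (G : set (treeAut d)) :
    pred (permutation (boundary d)) := fun f =>
  `[< exists T T' (s : word d -> word d) (phi : word d -> treeAut d),
      [/\ complete_subtree T, complete_subtree T',
          set_bij (leaves T) (leaves T') s,
          forall v, leaves T v -> G (phi v) &
          forall v xi, leaves T v ->
            f (bcat v xi) = bcat (s v) (boundary_act (phi v) xi)] >].

Section AlmostAutomorphismTheory.
Variables (d : nat) (G : selfSimilarGroup d).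
Implicit Types (f g : permutation (boundary d)) (u v w : word d).
Implicit Types (xi zeta : boundary d).

(* f maps v xi to w (g xi), for some g in G *)
Definition local_at f v w := exists2 g, ssgroup_set G g &
  forall xi, f (bcat v xi) = bcat w (boundary_act g xi).

Lemma local_at_cat f v w u : local_at f v w ->
  exists2 w', local_at f (v ++ u) (w ++ w') & size w' = size u.
Proof.
move=> [g Gg fg]; exists (g u); last exact: treeAut_size.
exists (section g u); first exact: ssgroup_self_similar.
by move=> xi; rewrite !bcat_cat fg boundary_act_bcat.
Qed.

Definition local_on f n := forall v, size v = n -> exists w, local_at f v w.

Lemma local_on_leq f m v : local_on f m -> (m <= size v)%N ->
  exists2 w, local_at f v w & (size v - m <= size w)%N.
Proof.
move=> fm mv; have [w /(@local_at_cat _ _ _ (drop m v))] :=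
  fm (take m v) (size_takel mv).
rewrite cat_take_drop => -[w' fw sw']; exists (w ++ w') => //.
by rewrite size_cat sw' size_drop leq_addl.
Qed.

Lemma finite_words n : finite_set [set v : word d | size v = n].
Proof.
apply: (@sub_finite_set _ _ ((fun t : n.-tuple 'I_d => tval t) @` setT)).
  by move=> v vn; exists (Tuple (introT eqP vn)).
exact: finite_image.
Qed.

Lemma finite_words_leq n : finite_set [set v : word d | (size v <= n)%N].
Proof.
apply: (@sub_finite_set _ _ (\bigcup_(k in `I_n.+1) [set v | size v = k])).
  by move=> v vn; exists (size v).
by apply: bigcup_finite => // k _; exact: finite_words.
Qed.

Lemma leaf_above (T : set (word d)) : complete_subtree T ->
  exists n, forall v, size v = n -> exists2 m, leaves T (take m v) & (m <= n)%N.
Proof.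
move=> [/finite_seqP[s Ts] [T0 Tpre] _ Tcompl].
pose n := (\max_(v <- s) size v).+1.
have Tn v : T v -> (size v < n)%N.
  by rewrite Ts /= ltnS => vs; exact: (leq_bigmax_seq (F := size)).
exists n => v vn; pose P m := `[< T (take m v) >] && (m <= n)%N.
have P0 : P 0 by rewrite /P take0 leq0n andbT; apply/asboolP.
have Pn m : P m -> (m <= n)%N by case/andP.
have [m /andP[/asboolP Tm mn] mmax] := ex_maxnP (ex_intro _ 0 P0) Pn.
exists m => //; split=> // x Tx.
have mltn : (m < n)%N by have := Tn _ Tm; rewrite size_takel // vn.
suff : P m.+1 by move=> /mmax; rewrite ltnn.
rewrite /P mltn andbT; apply/asboolP; rewrite (take_nth x) ?vn //.
exact: Tcompl Tx.
Qed.

Lemma almost_automorphism_local f :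
  almost_automorphism G f -> exists n, local_on f n.
Proof.
move=> /asboolP[T [T' [s [phi [cT cT' sbij Gphi fphi]]]]].
have [n Tn] := leaf_above cT; exists n => v vn.
have [m leafm mn] := Tn v vn.
have : local_at f (take m v) (s (take m v)).
  by exists (phi (take m v)); [exact: Gphi|move=> xi; exact: fphi].
move=> /(@local_at_cat _ _ _ (drop m v)); rewrite cat_take_drop => -[w fw _].
by exists (s (take m v) ++ w).
Qed.

Lemma local_almost_automorphism f n :
  local_on f n -> almost_automorphism G f.
Proof.
have [G1 _] := ssgroup_subgroup G.
move=> fn; have [d0|dgt0] := posnP d.
  have no (x : 'I_d) : False by case: x => m; rewrite d0.
  have T1 : complete_subtree [set [::] : word d].
    split; first exact: finite_set1.
    - by split=> // v x; case: (no x).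
    - by move=> x; case: (no x).
    - by move=> v x; case: (no x).
  apply/asboolP; exists [set [::]], [set [::]], id, (fun=> 1); split=> //.
  - by split=> // v Tv; exists v.
  - by move=> v xi; case: (no (xi 0)).
pose x0 : 'I_d := Ordinal dgt0; pose xi0 : boundary d := fun=> x0.
have {}fn v : exists wg : word d * treeAut d, size v = n.+1 ->
    [/\ wg.1 != [::], ssgroup_set G wg.2 &
     forall xi, f (bcat v xi) = bcat wg.1 (boundary_act wg.2 xi)].
  have [vn|vn] := pselect (size v = n.+1); last by exists ([::], 1).
  have [w [g Gg fg] sw] : exists2 w, local_at f v w & (size v - n <= size w)%N.
    by apply: local_on_leq => //; rewrite vn.
  exists (w, g) => _; split=> //=.
  by case: (w) sw => //; rewrite vn subSnn.
have [wg {}fn] := choice fn.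
pose w v := (wg v).1; pose phi v := (wg v).2.
pose T : set (word d) := [set v | (size v <= n.+1)%N].
pose T' : set (word d) := [set u | exists2 v, size v = n.+1 & prefix u (w v)].
have leavesT : leaves T = [set v | size v = n.+1].
  apply/seteqP; split=> v /=.
    move=> [Tv /(_ x0)]; rewrite /T /= size_rcons => vn.
    by apply/eqP; rewrite eqn_leq Tv /= leqNgt; apply/negP.
  by move=> vn; split=> [|x]; rewrite /T /= ?size_rcons vn // ltnn.
have w_leaf v v' u : size v = n.+1 -> size v' = n.+1 ->
    w v' = w v ++ u -> v = v' /\ u = [::].
  move=> vn v'n wu; have [_ _ fv] := fn v vn; have [_ _ fv'] := fn v' v'n.
  have : f (bcat v' (perm_inv (boundary_act (phi v')) xi0)) =
      f (bcat v (perm_inv (boundary_act (phi v)) (bcat u xi0))).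
    by rewrite fv fv' -/(w v) -/(w v') !perm_invK wu bcat_cat.
  move=> /(can_inj (perm_funK f)) /esym /bcat_take; rewrite vn v'n => /(_ (leqnn _)).
  rewrite take_oversize ?v'n // => E; split=> //.
  have /(congr1 size) := wu; rewrite E size_cat.
  by case: (u) => // a l /=; lia.
have leavesT' : leaves T' = [set w v | v in [set v | size v = n.+1]].
  apply/seteqP; split=> [u [[v vn /prefixP[t wv]] uleaf]|_ [v vn <-]].
    exists v => //; case: t wv => [|x t]; first by rewrite cats0.
    rewrite -cat_rcons => wv; case: (uleaf x); exists v => //.
    by rewrite wv prefix_prefix.
  split; first by exists v => //; exact: prefix_refl.
  move=> x [v' v'n /prefixP[t]].
  by rewrite cat_rcons => /(w_leaf _ _ _ vn v'n)[].
have T'child u x y : T' (rcons u x) -> T' (rcons u y).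
  move=> [v' v'n /prefixP[t wv']].
  pose xi := bcat (rcons u y) xi0; pose zeta := perm_inv f xi.
  pose v := mkseq zeta n.+1.
  have vn : size v = n.+1 by rewrite size_mkseq.
  have [_ _ fv] := fn v vn.
  have xiE : xi = bcat (w v) (boundary_act (phi v) (fun i => zeta (n.+1 + i)%N)).
    by rewrite -fv -bcat_split perm_invK.
  exists v => //; have [le|lt] := leqP (size (rcons u y)) (size (w v)).
    by rewrite prefixE; apply/eqP; rewrite -(bcat_take xiE le).
  exfalso; have wvu := bcat_take (esym xiE) (ltnW lt).
  have {wvu} : w v = take (size (w v)) u.
    rewrite size_rcons ltnS in lt.
    by rewrite {1}wvu -cats1 takel_cat.
  move=> wvu; move: wv'; rewrite cat_rcons -(cat_take_drop (size (w v)) u).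
  rewrite -wvu -catA => /(w_leaf _ _ _ vn v'n)[_].
  by case: drop.
apply/asboolP; exists T, T', w, phi; rewrite leavesT leavesT'; split.
- split; first exact: finite_words_leq.
  + by split=> // v x; rewrite /T /= size_rcons => /ltnW.
  + by [].
  + by move=> v x y; rewrite /T /= !size_rcons.
- pose v0 := nseq n.+1 x0; have v0n : size v0 = n.+1 by rewrite size_nseq.
  split=> //.
  + apply: (@sub_finite_set _ _ (\bigcup_(v in [set v | size v = n.+1])
        [set take k (w v) | k in `I_(size (w v)).+1])).
      move=> u [v vn]; rewrite prefixE => /eqP uE; exists v => //.
      exists (size u) => //=; rewrite ltnS -[in X in (X <= _)%N]uE.
      by rewrite size_take; case: ltnP => // /ltnW.
    apply: bigcup_finite; first exact: finite_words.
    by move=> v _; apply: finite_image.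
  + split; first by exists v0 => //; exact: prefix0s.
    move=> u x [v vn]; rewrite -cats1 => /prefixP[t]; rewrite -catA => wv.
    by exists v => //; rewrite wv prefix_prefix.
  + move=> x; have [wv0 _ _] := fn v0 v0n.
    have [y Ty] : exists y, T' [:: y].
      rewrite -/(w v0) in wv0; case E : (w v0) wv0 => [//|y l] _; exists y.
      by exists v0 => //; rewrite E -cat1s prefix_prefix.
    exact: (@T'child [::] y).
- split=> [v vn||u [v vn <-]]; [by exists v| |by exists v].
  move=> v v'; rewrite !inE => vn v'n wE.
  by have [] := w_leaf v v' [::] vn v'n; rewrite ?cats0.
- by move=> v /fn[].
- by move=> v xi /fn[].
Qed.

Lemma boundary_act_almost_automorphism (g : treeAut d) :
  ssgroup_set G g -> almost_automorphism G (boundary_act g).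
Proof.
move=> Gg; apply: (@local_almost_automorphism _ 0) => v /size0nil ->.
by exists [::], g => // xi; rewrite !bcat0.
Qed.

Lemma almost_automorphismM f g : almost_automorphism G f ->
  almost_automorphism G g -> almost_automorphism G (f * g).
Proof.
move=> /almost_automorphism_local[m fm] /almost_automorphism_local[n gn].
apply: (@local_almost_automorphism _ (n + m)) => v vnm.
have [|w [h Gh gh]] := @local_on_leq g n v gn; first by rewrite vnm leq_addr.
rewrite vnm addKn => mw; have [w' [k Gk fk] _] := local_on_leq fm mw.
exists w', (k * h); last by move=> xi; rewrite boundary_actM -fk -gh.
have [G1 GV] := ssgroup_subgroup G.
by rewrite -[h]invgK -[h^-1]mul1g; apply: (GV) => //; exact: GV.
Qed.

Lemma almost_automorphismV f :
  almost_automorphism G f -> almost_automorphism G f^-1.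
Proof.
move=> /asboolP[T [T' [s [phi [cT cT' [sfun sinj ssurj] Gphi fphi]]]]].
have [G1 GV] := ssgroup_subgroup G.
have /choice[t ts] u : exists v, leaves T' u -> leaves T v /\ s v = u.
  have [/ssurj[v Tv sv]|nTu] := pselect (leaves T' u); first by exists v.
  by exists u.
apply/asboolP; exists T', T, t, (fun u => (phi (t u))^-1); split=> //.
- split=> [u /ts[]//|u v|v Tv].
    rewrite !inE => /ts[_ su] /ts[_ sv] tuv.
    by rewrite -su -sv tuv.
  exists (s v); first exact: sfun.
  have [Tv' sv'] := ts (s v) (sfun v Tv).
  by apply: sinj => //; rewrite inE.
- by move=> u /ts[/Gphi Gu _]; rewrite -[_^-1]mul1g; exact: GV.
- move=> u xi /ts[Tu su]; apply: (can_inj (perm_funK f)).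
  by rewrite perm_invK fphi // su perm_invK.
Qed.

Lemma almost_automorphism_group_closed :
  group_closed (@almost_automorphism d G).
Proof.
split.
  rewrite /in_mem /= -boundary_act1.
  by apply: boundary_act_almost_automorphism; have [] := ssgroup_subgroup G.
by move=> f g Gf Gg; apply: almost_automorphismM => //; exact: almost_automorphismV.
Qed.

End AlmostAutomorphismTheory.

Record AAut (d : nat) (G : selfSimilarGroup d) := MkAAut {
  AAut_perm :> permutation (boundary d);
  AAutP : almost_automorphism G AAut_perm
}.

HB.instance Definition _ d (G : selfSimilarGroup d) :=
  [isSub for @AAut_perm d G].
HB.instance Definition _ d (G : selfSimilarGroup d) :=
  [Choice of AAut G by <:].
HB.instance Definition _ d (G : selfSimilarGroup d) :=
  SubChoice_isSubGroup.Build (permutation (boundary d))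
    (@almost_automorphism d G) (AAut G)
    (@almost_automorphism_group_closed d G).

Definition AAut_of (d : nat) (G : selfSimilarGroup d) (V : set (treeAut d)) :
    set (AAut G) :=
  [set a | exists2 g, V g & AAut_perm a = boundary_act g].
Arguments AAut_of {d} G V.

(* A group topology is determined by the neighbourhoods of 1, so the one below
   is the only candidate for a group topology on AAut G in which G is open and
   has the topology induced from treeAut d (see AAut_openP). *)

Section AAutTopology.
Variables (d : nat) (G : selfSimilarGroup d).
Implicit Types (a b : AAut G) (U : set (AAut G)) (V W : set (treeAut d)).

Definition AAut_open U : Prop :=
  forall a, U a -> exists2 V, nbhs (1 : treeAut d) V &
    forall b, AAut_of G (ssgroup_set G `&` V) b -> U (a * b).

Let openT : AAut_open setT.
Proof. by move=> a _; exists setT => //; exact: filterT. Qed.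

Let openI : setI_closed AAut_open.
Proof.
move=> U U' Uo Uo' a [/Uo[V V1 UV] /Uo'[V' V'1 UV']].
exists (V `&` V'); first exact: filterI.
by move=> b [g [Gg [Vg V'g]] bg]; split; [apply: UV|apply: UV']; exists g.
Qed.

Let open_bigU (I : Type) (f : I -> set (AAut G)) :
  (forall i, AAut_open (f i)) -> AAut_open (\bigcup_i f i).
Proof.
move=> fo a [i _ /fo[V V1 fV]]; exists V => // b /fV fab.
by exists i.
Qed.

HB.instance Definition _ :=
  isOpenTopological.Build (AAut G) openT openI open_bigU.

Lemma AAut_openP V : V `<=` ssgroup_set G ->
  open (AAut_of G V) <-> exists2 W, open W & V = ssgroup_set G `&` W.
Proof.
move=> VG; have [G1 GV] := ssgroup_subgroup G.
have GM g h : ssgroup_set G g -> ssgroup_set G h -> ssgroup_set G (g * h).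
  by move=> Gg Gh; rewrite -[h]invgK -[h^-1]mul1g; apply: (GV) => //; exact: GV.
pose emb g (Gg : ssgroup_set G g) : AAut G :=
  MkAAut (boundary_act_almost_automorphism Gg).
split=> [Vo|[W Wo ->]]; last first.
  suff: AAut_open (AAut_of G (ssgroup_set G `&` W)) by [].
  move=> a [g [Gg Wg] ag]; have [n Wn] := Wo g Wg; exists (@level_stab d n).
    by apply/treeAut_nbhsP; exists n => h; rewrite mul1g.
  move=> b [h [Gh hn] bh]; exists (g * h); last by rewrite boundary_actM -ag -bh.
  by split; [exact: GM|exact: Wn].
exists [set k | exists g n, [/\ V g, level_stab n (g^-1 * k) &
    forall h, ssgroup_set G h -> level_stab n h -> V (g * h)]].
  move=> k [g [n [Vg kn gn]]]; exists n => h hn; exists g, n; split=> //.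
  by rewrite mulgA; exact: level_stabM.
apply/seteqP; split=> [g Vg|k [Gk [g [n [Vg kn gn]]]]]; last first.
  rewrite -(mulVKg g k); apply: gn => //; apply: GM => //.
  by rewrite -[g^-1]mul1g; apply: GV => //; exact: VG.
split; first exact: VG.
have [|X /treeAut_nbhsP[n Xn] VX] := Vo (emb g (VG g Vg)); first by exists g.
exists g, n; split=> //; first by rewrite mulVg.
move=> h Gh /Xn; rewrite mul1g => Xh.
have [|k Vk] := VX (emb h Gh); first by exists h.
by rewrite /= -[LHS]boundary_actM => /boundary_act_inj ->.
Qed.

End AAutTopology.

(* The letter (x, e) stands for x if e = false, and for x^-1 if e = true. *)

Definition gen_word (A : Type) (S : set A) := seq (S * bool).

Definition gen_eval (A : groupType) (S : set A) (w : gen_word S) : A :=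
  \prod_(l <- w) (if l.2 then (val l.1)^-1 else val l.1).

(* Equality of words in the abstract group < S | R > *)
Inductive presented_eq (A : Type) (S : set A) (R : set (gen_word S)) :
    gen_word S -> gen_word S -> Prop :=
| presented_refl w : presented_eq R w w
| presented_sym w w' : presented_eq R w w' -> presented_eq R w' w
| presented_trans w w' w'' :
    presented_eq R w w' -> presented_eq R w' w'' -> presented_eq R w w''
| presented_cancel u v x e :
    presented_eq R (u ++ [:: (x, e); (x, ~~ e)] ++ v) (u ++ v)
| presented_relator u v r :
    R r -> presented_eq R (u ++ r ++ v) (u ++ v).

Definition presentation (A : groupType) (S : set A) (R : set (gen_word S)) :
    Prop :=
  generated S = [set: A] /\
  forall w w' : gen_word S, gen_eval w = gen_eval w' <-> presented_eq R w w'.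

Definition compactly_presented (A : preTopologicalGroupType) : Prop :=
  exists (S : set A) (R : set (gen_word S)),
    [/\ compact S, presentation R &
        exists n, forall r, R r -> (size r <= n)%N].

(* Main.v *)
Require Import Defs.
From HB Require Import structures.
From mathcomp Require Import all_boot all_classical.
From mathcomp Require Import topology.
From mathcomp Require Import finmap generic_quotient zify.

(* A "brick" is a piece k o G of the boundary, where k is an injective map that
   is locally of the form v xi |-> w g(xi) with g in G; a "paving" x is a finite
   partition of the boundary into bricks, of a cardinality that occurs as a
   number of leaves.  An almost automorphism a "fits" x if x is the image under a
   of the partition into the cones at the leaves of some tree.  Generate AAut by
   the compact set of quotients a^-1 b with a and b fitting a common paving of at
   most 6 d bricks, and take the relators of length at most 3.

   A relation is a loop in the Cayley graph; all its vertices fit one common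
   paving, so it is enough to lift the set D(x) of the elements that fit x to the
   presented group, compatibly with the edges.  This is done by induction on the
   number of bricks of x.  A "caret" of x is a brick whose d children belong to x,
   and contracting it gives a smaller paving x' with D(x') contained in D(x).  In
   a large paving any five carets have a common disjoint caret; hence the complex
   of carets of x, with a simplex for pairwise disjoint carets, is simply
   connected, and the lifts on the D(x') glue to a lift on D(x).

   Branching over a congruence subgroup makes the conjugates of small neighbourhoods of 1 in G
   small again, which gives the topological statements and the finiteness of the
   set of cosets of G that meet the generating set. *)

Set Implicit Arguments.
Unset Strict Implicit.
Unset Printing Implicit Defensive.

Local Open Scope classical_set_scope.
Local Open Scope group_scope.

(** * The group of a presentation *)

Section PresentedGroup.
Local Open Scope quotient_scope.
Variables (A : choiceType) (S : set A) (R : set (gen_word S)).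
Local Notation W := (gen_word S).

Definition letter_eval (P : groupType) (j : S -> P) (l : S * bool) : P :=
  if l.2 then (j l.1)^-1 else j l.1.

Definition word_eval (P : groupType) (j : S -> P) (w : W) : P :=
  \prod_(l <- w) letter_eval j l.

Definition presented_rel (w w' : W) : bool := `[< presented_eq R w w' >].

Lemma presented_rel_equiv : equiv_class_of presented_rel.
Proof.
split=> [w|w w'|w' w w''].
- exact/asboolP/presented_refl.
- by apply/asboolP/asboolP; exact: presented_sym.
- by move=> /asboolP E /asboolP E'; apply/asboolP/(presented_trans E E').
Qed.
Canonical presented_equiv := EquivRelPack presented_rel_equiv.

Definition presented_group := {eq_quot presented_equiv}.
HB.instance Definition _ := Choice.on presented_group.
HB.instance Definition _ := EqQuotient.on presented_group.
Local Notation P := presented_group.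
Local Notation "w ~ w'" := (presented_eq R w w') (at level 70).

Lemma presented_piP (w w' : W) : \pi_P w = \pi_P w' <-> w ~ w'.
Proof. by split=> [/eqmodP/asboolP//|E]; apply/eqmodP/asboolP. Qed.

Lemma presented_reprK (w : W) : repr (\pi_P w) ~ w.
Proof. by apply/presented_piP; rewrite reprK. Qed.

Lemma presented_cat (u u' v v' : W) : u ~ u' -> v ~ v' -> u ++ v ~ u' ++ v'.
Proof.
move=> E E'; apply: (@presented_trans _ _ _ _ (u ++ v')).
  elim: E' => {v v'} [w|w w' _ IH|w w' w'' _ IH _ IH'|a b x e|a b r Rr].
  - exact: presented_refl.
  - exact: presented_sym.
  - exact: presented_trans IH'.
  - by rewrite !(catA u); exact: presented_cancel.
  - by rewrite !(catA u); exact: presented_relator.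
elim: E => {u u'} [w|w w' _ IH|w w' w'' _ IH _ IH'|a b x e|a b r Rr].
- exact: presented_refl.
- exact: presented_sym.
- exact: presented_trans IH'.
- by rewrite -!catA; exact: presented_cancel.
- by rewrite -!catA; exact: presented_relator.
Qed.

Definition inv_word (w : W) : W := rev [seq (l.1, ~~ l.2) | l <- w].

Lemma inv_wordK : involutive inv_word.
Proof.
move=> w; rewrite /inv_word map_rev revK -map_comp -[RHS]map_id.
by apply: eq_map => -[x e] /=; rewrite negbK.
Qed.

Lemma presented_cat_inv w : w ++ inv_word w ~ [::].
Proof.
elim: w => [|[x e] w IH]; first exact: presented_refl.
rewrite /inv_word /= rev_cons -cats1 catA -cat_cons.
apply: (@presented_trans _ _ _ _ ([:: (x, e)] ++ [:: (x, ~~ e)])).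
  apply: presented_cat; last exact: presented_refl.
  by rewrite -cat1s -[X in _ ~ X]cats0; apply: presented_cat => //; exact: presented_refl.
exact: (@presented_cancel _ _ _ [::] [::]).
Qed.

(** Uniqueness of inverses, run on words: both sides equal [inv_word w ++ w' ++ inv_word w']. *)
Lemma presented_inv w w' : w ~ w' -> inv_word w ~ inv_word w'.
Proof.
move=> E; apply: (@presented_trans _ _ _ _ (inv_word w ++ (w' ++ inv_word w'))).
  rewrite -[X in X ~ _]cats0; apply: presented_cat; first exact: presented_refl.
  exact/presented_sym/presented_cat_inv.
rewrite catA -[X in _ ~ X]cat0s; apply: presented_cat; last exact: presented_refl.
apply: (@presented_trans _ _ _ _ (inv_word w ++ w)).
  apply: presented_cat; first exact: presented_refl.
  exact: presented_sym.
by rewrite -{2}[w]inv_wordK; exact: presented_cat_inv.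
Qed.

Definition presented_one : P := \pi_P [::].
Definition presented_mul (p q : P) : P := \pi_P (repr p ++ repr q).
Definition presented_invg (p : P) : P := \pi_P (inv_word (repr p)).

Lemma presented_mul_pi (u v : W) :
  presented_mul (\pi_P u) (\pi_P v) = \pi_P (u ++ v).
Proof. by apply/presented_piP/presented_cat; exact: presented_reprK. Qed.

Lemma presented_inv_pi (u : W) : presented_invg (\pi_P u) = \pi_P (inv_word u).
Proof. by apply/presented_piP/presented_inv/presented_reprK. Qed.

Fact presented_mulA : associative presented_mul.
Proof.
move=> p q r; rewrite -[p]reprK -[q]reprK -[r]reprK.
by rewrite !(presented_mul_pi (repr _) (repr _)) !presented_mul_pi catA.
Qed.

Fact presented_mul1 : left_id presented_one presented_mul.
Proof. move=> p. by rewrite -[p]reprK presented_mul_pi. Qed.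

Fact presented_mulr1 : right_id presented_one presented_mul.
Proof. by move=> p; rewrite -[p]reprK presented_mul_pi cats0. Qed.

Fact presented_mulV : left_inverse presented_one presented_invg presented_mul.
Proof.
move=> p; rewrite -[p]reprK presented_inv_pi presented_mul_pi; apply/presented_piP.
by rewrite -{2}[repr p]inv_wordK; exact: presented_cat_inv.
Qed.

Fact presented_mulVr : right_inverse presented_one presented_invg presented_mul.
Proof.
move=> p; rewrite -[p]reprK presented_inv_pi presented_mul_pi; apply/presented_piP.
exact: presented_cat_inv.
Qed.

HB.instance Definition _ := isGroup.Build presented_group presented_mulA
  presented_mul1 presented_mulr1 presented_mulV presented_mulVr.

Definition presented_gen (s : S) : P := \pi_P [:: (s, false)].

(** Turns equality of classes into equality of products in a group, which is the form that lifts
    produce. *)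
Lemma word_eval_presented (w : W) : word_eval presented_gen w = \pi_P w.
Proof.
rewrite /word_eval; elim: w => [|[s e] w IH]; first by rewrite big_nil.
rewrite big_cons IH -cat1s -[RHS]presented_mul_pi; congr (_ * _).
rewrite /letter_eval /=; case: e => //.
by rewrite /presented_gen [LHS]presented_inv_pi.
Qed.

End PresentedGroup.

(** * The topology of AAut G *)

Section Subgroup.
Variables (A : groupType) (H : set A).
Hypothesis Hsub : subgroup H.

Lemma subgroup1 : H 1. Proof. by case: Hsub. Qed.

Lemma subgroupV x : H x -> H x^-1.
Proof. by move=> Hx; rewrite -[x^-1]mul1g; apply: Hsub.2 => //; exact: subgroup1. Qed.

Lemma subgroupM x y : H x -> H y -> H (x * y).
Proof. by move=> Hx /subgroupV Hy; rewrite -[y]invgK; exact: Hsub.2. Qed.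

End Subgroup.

(** * Automorphisms with prescribed sections on a level *)

Section Spread.
Variables (d : nat) (n : nat).
Implicit Types (u : word d -> treeAut d) (v w : word d).

(** The inverse of the [n]-fold wreath recursion, for trivial action on level [n]. Only the values
    of [u] at words of length [n] matter. *)
Definition spread_fun u w :=
  if (n <= size w)%N then take n w ++ u (take n w) (drop n w) else w.

Lemma spread_fun_cat u v w : size v = n -> spread_fun u (v ++ w) = v ++ u v w.
Proof.
by move=> vn; rewrite /spread_fun size_cat vn leq_addr take_size_cat // drop_size_cat.
Qed.

Lemma spread_fun_short u w : (size w <= n)%N -> spread_fun u w = w.
Proof.
rewrite /spread_fun leq_eqVlt => /orP[/eqP wn|]; last by rewrite ltnNge => /negPf->.
by rewrite wn leqnn take_oversize ?wn // drop_oversize ?wn // treeAut0 cats0.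
Qed.

Lemma spread_funK u : cancel (spread_fun u) (spread_fun (fun v => (u v)^-1)).
Proof.
move=> w; have [nw|/ltnW wn] := leqP n (size w); last first.
  by rewrite !spread_fun_short // spread_fun_short.
rewrite -{1}(cat_take_drop n w) !spread_fun_cat ?size_takel //.
by rewrite treeAutVK cat_take_drop.
Qed.

Lemma spread_invK u : cancel (spread_fun (fun v => (u v)^-1)) (spread_fun u).
Proof.
rewrite {2}(_ : u = fun v => ((u v)^-1)^-1); first exact: spread_funK.
by apply/funext => v; rewrite invgK.
Qed.

Definition spread_perm u := Permutation (spread_funK u) (spread_invK u).

Lemma spread_tree_automorphism u : tree_automorphism (spread_perm u).
Proof.
have rconsE t w x : exists y, spread_fun t (rcons w x) = rcons (spread_fun t w) y.
  have [nw|wn] := leqP n (size w); last first.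
    by exists x; rewrite !spread_fun_short ?size_rcons // ltnW.
  rewrite -(cat_take_drop n w); have vn : size (take n w) = n by rewrite size_takel.
  move: {w nw} (take n w) vn (drop n w) => v vn w.
  have [y E] := treeAut_rcons (t v) w x; exists y.
  by rewrite rcons_cat !spread_fun_cat // E rcons_cat.
have adj t v w : tree_adj v w -> tree_adj (spread_fun t v) (spread_fun t w).
  move=> [] [x ->]; [left; have [y ->] := rconsE t v x|
    right; have [y ->] := rconsE t w x]; by exists y.
apply/asboolP; split=> [|v w]; first exact: (@spread_fun_short u [::] (leq0n n)).
split; last exact: adj.
by move=> /(adj (fun v => (u v)^-1)); rewrite /= !spread_funK.
Qed.

Definition spread u : treeAut d := TreeAut (spread_tree_automorphism u).

Lemma spread_cat u v w : size v = n -> spread u (v ++ w) = v ++ u v w.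
Proof. exact: spread_fun_cat. Qed.

Lemma spread_fix u v : size v = n -> spread u v = v.
Proof. by move=> vn; apply: spread_fun_short; rewrite vn. Qed.

Lemma section_spread u v : size v = n -> section (spread u) v = u v.
Proof.
by move=> vn; apply: eq_section => w; rewrite spread_cat // spread_fix.
Qed.

Lemma spread_act u v xi : size v = n ->
  boundary_act (spread u) (bcat v xi) = bcat v (boundary_act (u v) xi).
Proof. by move=> vn; rewrite boundary_act_bcat section_spread // spread_fix. Qed.

End Spread.

(** * Branching over a congruence subgroup *)

Definition branching (d : nat) (G : set (treeAut d)) (n0 : nat) := forall n g,
  level_stab n g ->
  (forall v, size v = n -> G (section g v) /\ level_stab n0 (section g v)) ->
  G g.

Section Branching.
Variables (d : nat) (H : selfSimilarGroup d) (K : set (treeAut d)).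

(** Iterates the inclusion of [K x ... x K] in the image of [K] under [psi], one level at a time. *)
Lemma branch_subgroup_spread : regular_branch_over H K -> forall n g,
  level_stab n g -> (forall v, size v = n -> K (section g v)) -> K g.
Proof.
move=> [_ [_ Kbase _]].
have lev1 g : level_stab 1 g -> (forall x, K (section g [:: x])) -> K g.
  move=> g1 gK; suff /Kbase[k Kk /psi_inj <-] : base_power K (psi g) by [].
  split=> //; apply: permutation_ext => x.
  suff [] : [:: level1 g x] = [:: x] by [].
  by rewrite -level1E g1.
elim=> [|n IH] g gn gK.
  rewrite (_ : g = section g [::]); first exact: gK.
  by apply/esym/eq_section => w; rewrite treeAut0.
apply: IH => [|v vn]; first exact: level_stab_leq gn.
apply: lev1 => [w w1|x].
  have := gn (v ++ w); rewrite size_cat vn w1 addn1 => /(_ erefl).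
  rewrite section_cat (level_stab_leq (leqnSn n) gn) // => /eqP.
  by rewrite eqseq_cat // eqxx => /eqP.
by rewrite -section_comp; apply: gK; rewrite size_cat vn addn1.
Qed.

(** [n0] is a level whose stabilizer in [H] lies in [K]. Each section of [g] is approximated in [H]
    to depth [n + n0], so that the approximation is still trivial on level [n0] and falls into [K];
    spreading these elements approximates [g] inside [K]. *)
Lemma branching_closure : regular_branch_over H K -> congruence_subgroup H K ->
  exists n0, branching (closure H) n0.
Proof.
move=> HK [[_ KH _] [n0 Kn0]]; exists n0 => m g gm gsec.
apply/treeAut_closureP => n.
have /choice[h hP] v : exists h, size v = m ->
    ssgroup_set H h /\ level_stab (n + n0) (h^-1 * section g v).
  have [/gsec[/treeAut_closureP/(_ (n + n0)%N)[h Hh hE] _]|] := pselect (size v = m).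
    by exists h => _; split=> //; apply/level_stab_eq => w /hE.
  by exists 1.
have Kh : K (spread m h).
  apply: (branch_subgroup_spread HK (n := m)) => [v|v vm]; first exact: spread_fix.
  rewrite section_spread //; have [Hh hn] := hP v vm; have [_ gn0] := gsec v vm.
  apply: Kn0; split=> // w wn0; rewrite -[RHS](gn0 w wn0).
  by have /level_stab_eq -> := level_stab_leq (leq_addl n n0) hn.
exists (spread m h); first exact: KH.
move=> v vn; have /level_stab_eq/(_ v vn)-> // : level_stab n ((spread m h)^-1 * g).
apply: (@level_stab_leq _ _ (m + n)); first exact: leq_addl.
apply/level_stab_eq => w wmn; rewrite -(cat_take_drop m w).
have wm : size (take m w) = m by rewrite size_takel // wmn leq_addr.
rewrite spread_cat // section_cat gm //; congr (_ ++ _).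
have [_ /(level_stab_leq (leq_addr n0 n))/level_stab_eq-> //] := hP _ wm.
by rewrite size_drop wmn addKn.
Qed.

End Branching.

(** * Basic neighbourhoods of 1 and local compactness *)

Section Topology.
Variables (d : nat) (G : selfSimilarGroup d) (n0 : nat).
Hypothesis Gbranch : branching G n0.
Implicit Types (a b c : AAut G) (g h : treeAut d).

Let G1 : ssgroup_set G 1 := subgroup1 (ssgroup_subgroup G).
Let GM := subgroupM (ssgroup_subgroup G).
Let GV := subgroupV (ssgroup_subgroup G).

Definition stab_nbhs n : set (AAut G) := AAut_of G (ssgroup_set G `&` @level_stab d n).

Lemma level_stabV n g : level_stab n g -> level_stab n g^-1.
Proof. by move=> gn v vn; rewrite -{1}(gn v vn) treeAutVK. Qed.

Lemma level_stabJ n g h : level_stab n h -> level_stab n (g^-1 * h * g).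
Proof.
by move=> hn v vn; rewrite !treeAutME hn ?treeAut_size // treeAutVK.
Qed.

Lemma stab_nbhs1 n : stab_nbhs n 1.
Proof. by exists 1; [split=> // v|rewrite boundary_act1]. Qed.

Lemma stab_nbhsM n a b : stab_nbhs n a -> stab_nbhs n b -> stab_nbhs n (a * b).
Proof.
move=> [g [Gg gn] ag] [h [Gh hn] bh]; exists (g * h).
  by split; [exact: GM|exact: level_stabM].
by rewrite boundary_actM -ag -bh.
Qed.

Lemma boundary_actV g : boundary_act g^-1 = (boundary_act g)^-1.
Proof.
rewrite -[LHS]mulg1 -(mulgV (boundary_act g)) mulgA -boundary_actM mulVg.
by rewrite boundary_act1 mul1g.
Qed.

Lemma stab_nbhsV n a : stab_nbhs n a -> stab_nbhs n a^-1.
Proof.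
move=> [g [Gg gn] ag]; exists g^-1.
  by split; [exact: GV|exact: level_stabV].
by rewrite boundary_actV -ag.
Qed.

Lemma AAut_nbhsP a (W : set (AAut G)) :
  nbhs a W <-> exists n, forall b, stab_nbhs n b -> W (a * b).
Proof.
split=> [[V [Vo Va VW]]|[n nW]].
  have [X /treeAut_nbhsP[n Xn] VX] := Vo a Va; exists n => b [g [Gg gn] bg].
  by apply/VW/VX; exists g => //; split=> //; rewrite -[g]mul1g; exact: Xn.
have aUo : AAut_open [set a * b | b in stab_nbhs n].
  move=> _ [b bn <-]; exists (@level_stab d n).
    by apply/treeAut_nbhsP; exists n => h; rewrite mul1g.
  move=> c cn; exists (b * c); last by rewrite mulgA.
  exact: stab_nbhsM.
exists [set a * b | b in stab_nbhs n]; split=> [//||_ [b bn <-]]; last exact: nW.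
by exists 1; [exact: stab_nbhs1|rewrite mulg1].
Qed.

(* a^-1 b a fixes the level at which a is local; there its sections are conjugates
   of sections of b in the n0-th level stabilizer of G, so that branching applies. *)
Lemma stab_nbhsJ a n : exists m, forall b, stab_nbhs m b -> stab_nbhs n (a^-1 * b * a).
Proof.
have [L aL] := almost_automorphism_local (AAutP a).
have /choice[wg wgP] (v : word d) : exists wg : word d * treeAut d, size v = L ->
    ssgroup_set G wg.2 /\
    forall xi, a (bcat v xi) = bcat wg.1 (boundary_act wg.2 xi).
  have [/aL[w [g Gg ag]]|] := pselect (size v = L); first by exists (w, g).
  by exists ([::], 1).
(* An element that fixes level [M + (n0 + n)] fixes every word [(wg v).1] and at least [n0 + n]
   levels below it. *)
pose M := \max_(t : L.-tuple 'I_d) size (wg t).1.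
exists (M + (n0 + n))%N => b [h [Gh hm] bh].
pose u v := (wg v).2^-1 * section h (wg v).1 * (wg v).2.
have secM v : size v = L -> level_stab (n0 + n) (section h (wg v).1).
  move=> vL w wn; have : level_stab (size ((wg v).1 ++ w)) h.
    apply: level_stab_leq hm; rewrite size_cat wn leq_add2r.
    exact: (leq_bigmax (Tuple (introT eqP vL))).
  move=> hw; have := hw _ erefl; rewrite section_cat.
  rewrite (@level_stab_leq _ (size (wg v).1) _ _ h hw) ?size_cat ?leq_addr // => /eqP.
  by rewrite eqseq_cat // eqxx => /eqP.
exists (spread L u); last first.
  apply: permutation_ext => xi; rewrite (bcat_split L xi).
  rewrite spread_act ?size_mkseq //.
  apply: (can_inj (perm_funK a)).
  transitivity (b (a (bcat (mkseq xi L) (fun i => xi (L + i)%N)))).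
    exact: perm_invK.
  have vL : size (mkseq xi L) = L by rewrite size_mkseq.
  have [Gv av] := wgP _ vL; rewrite !av bh boundary_act_bcat /u.
  set w := (wg _).1; have -> : h w = w.
    apply: (@level_stab_leq _ (size w) (M + (n0 + n)) _ h hm) => //.
    apply: leq_trans (leq_addr _ _).
    exact: (leq_bigmax (Tuple (introT eqP vL))).
  congr bcat; rewrite !boundary_actM boundary_actV.
  exact/esym/(perm_invK (boundary_act _)).
have un0 v : size v = L -> level_stab (n0 + n) (u v).
  by move=> vL; exact/level_stabJ/secM.
split.
  apply: (Gbranch (n := L)) => [v|v vL]; first exact: spread_fix.
  rewrite section_spread //; split.
    have [Gv _] := wgP v vL; apply: (GM _ Gv); apply: GM; first exact: GV.
    exact: ssgroup_self_similar.
  by apply: level_stab_leq (un0 v vL); exact: leq_addr.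
apply: (@level_stab_leq _ _ (L + (n0 + n))); first by rewrite addnA leq_addl.
move=> v vn; rewrite -(cat_take_drop L v).
have tL : size (take L v) = L by rewrite size_takel // vn leq_addr.
by rewrite spread_cat // un0 // size_drop vn addKn.
Qed.

(** Basic neighbourhoods are left cosets; moving a factor across [b], or inverting, costs a
    conjugation, which [stab_nbhsJ] controls. *)
Lemma AAut_topological_group : topological_group (AAut G).
Proof.
split=> [[a b]|a] W /AAut_nbhsP[n nW].
  have [m mn] := stab_nbhsJ b n.
  exists ([set a * c | c in stab_nbhs m], [set b * c | c in stab_nbhs n]) => /=.
    by split; apply/AAut_nbhsP; [exists m|exists n] => c; exists c.
  move=> [_ _] [/= [c cm <-] [e en <-]]; rewrite /preimage /=.
  have -> : a * c * (b * e) = a * b * ((b^-1 * c * b) * e).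
    by rewrite !mulgA mulgK.
  by apply: nW; apply: stab_nbhsM => //; exact: mn.
have [m mn] := stab_nbhsJ a^-1 n; apply/AAut_nbhsP; exists m => c cm.
rewrite /= /preimage /= (_ : _^-1 = a^-1 * (a^-1^-1 * c^-1 * a^-1)).
  by apply/nW/mn/stab_nbhsV.
by rewrite invgM invgK !mulgA mulVg mul1g.
Qed.

Lemma coset_open a n : open [set a * b | b in stab_nbhs n].
Proof.
rewrite openE => _ [b bn <-]; apply/AAut_nbhsP; exists n => c cn.
by exists (b * c); [exact: stab_nbhsM|rewrite mulgA].
Qed.

Lemma coset_closed a n : closed [set a * b | b in stab_nbhs n].
Proof.
rewrite -openC openE => c nc; apply/AAut_nbhsP; exists n => b bn [e en E].
apply: nc; exists (e * b^-1); first by apply: stab_nbhsM => //; exact: stab_nbhsV.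
by rewrite mulgA E mulgK.
Qed.

Lemma AAut_zero_dimensional : zero_dimensional (AAut G).
Proof.
move=> a b /eqP nab.
(* The sets [stab_nbhs n] intersect in 1, since an automorphism that fixes every level is
   trivial. *)
have [n nn] : exists n, ~ stab_nbhs n (a^-1 * b).
  apply: contrapT => /forallNP all; apply: nab; apply/(mulgI a^-1); rewrite mulVg.
  have {}all n : stab_nbhs n (a^-1 * b) by exact: contrapT (all n).
  have [g _ abg] := all 0; suff g1 : g = 1.
    by apply: val_inj; rewrite /= [RHS]abg g1 boundary_act1.
  apply: treeAut_ext => v; have [h [_ hv] abh] := all (size v).
  by rewrite (boundary_act_inj (etrans (esym abg) abh)) hv.
exists [set a * c | c in stab_nbhs n]; split; last first.
- by move=> [c cn E]; apply: nn; rewrite -E mulKg.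
- by exists 1; [exact: stab_nbhs1|rewrite mulg1].
by split; [exact: coset_open|exact: coset_closed].
Qed.

Lemma zero_dimensional_hausdorff (T : topologicalType) :
  zero_dimensional T -> hausdorff_space T.
Proof.
move=> Tzero x y xy; apply: contrapT => /eqP nxy.
have [U [[Uo Uc] Ux nUy]] := Tzero _ _ nxy.
have [|z [Uz nUz]] := xy U (~` U) (open_nbhs_nbhs (conj Uo Ux)).
  by apply: open_nbhs_nbhs; split=> //; exact: closed_openC.
exact: nUz.
Qed.

Hypothesis Gclosed : closed (ssgroup_set G).

(** An ultrafilter contains each fibre or its complement, and it cannot contain the complements of
    all the finitely many fibres over [D]. *)
Lemma ultra_finite (T : Type) (F : set_system T) (X : choiceType) (f : T -> X)
    (D : set X) : UltraFilter F -> finite_set D -> F (f @^-1` D) ->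
  exists x, F (f @^-1` [set x]).
Proof.
move=> FU /finite_fsetP[E ->] FE; apply: contrapT => /forallNP no.
have /filter_bigI FI x : x \in E -> F (~` (f @^-1` [set x])).
  by move=> _; case: (in_ultra_setVsetC (f @^-1` [set x]) FU) => // /no.
have [t [Et /(_ _ Et)]] := filter_ex (filterI FE FI); exact.
Qed.

(** Along an ultrafilter the image of each word takes finitely many values, hence is eventually
    constant, and so is its preimage. The limits form an automorphism, which lies in [G] because [G]
    is closed. *)
Lemma stab_nbhs0_compact : compact (stab_nbhs 0).
Proof.
rewrite compact_ultra => F FU FB; have FF : ProperFilter F := ultra_proper.
have /choice[gam gamP] c : exists g, stab_nbhs 0 c ->
    ssgroup_set G g /\ AAut_perm c = boundary_act g.
  by have [[g [Gg _] cg]|] := pselect (stab_nbhs 0 c); [exists g|exists 1].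
have lim (f : AAut G -> treeAut d) v : exists w, F ((fun c => f c v) @^-1` [set w]).
  apply: (@ultra_finite _ F (word d) _ [set w | size w = size v] FU); first exact: finite_words.
  by apply: filterS filterT => c _ /=; rewrite treeAut_size.
have /choice[l lP] := lim gam; have /choice[l' l'P] := lim (fun c => (gam c)^-1).
have lK : cancel l l'.
  move=> v; have [c [/= <- <-]] := filter_ex (filterI (lP v) (l'P (l v))).
  exact: (perm_funK (gam c)).
have l'K : cancel l' l.
  move=> v; have [c [/= <- <-]] := filter_ex (filterI (l'P v) (lP (l' v))).
  exact: (perm_invK (gam c)).
have ltree : tree_automorphism (Permutation lK l'K).
  apply/asboolP; split=> [|u v] /=.
    by have [c /= <-] := filter_ex (lP [::]); rewrite treeAut0.
  have [c [/= <- <-]] := filter_ex (filterI (lP u) (lP v)).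
  by have /asboolP[_ ->] := treeAutP (gam c).
pose g := TreeAut ltree.
have near n : F [set c | stab_nbhs 0 c /\ level_stab n (g^-1 * gam c)].
  apply: filterI => //; have /finite_fsetP[D DE] := finite_words d n.
  have FI : F (\bigcap_(v in [set` D]) ((fun c => gam c v) @^-1` [set l v])).
    by apply: filter_bigI => v _; exact: lP.
  apply: (filterS _ FI) => c cD; apply/level_stab_eq => v vn.
  by apply: (cD v); rewrite -DE.
have Gg : ssgroup_set G g.
  apply: Gclosed; apply/treeAut_closureP => n.
  have [c [/gamP[Gc _] cn]] := filter_ex (near n); exists (gam c) => //.
  exact/level_stab_eq.
pose e : AAut G := MkAAut (boundary_act_almost_automorphism Gg).
exists e; split; first by exists g => //; split=> // v /size0nil ->; rewrite treeAut0.
move=> W /AAut_nbhsP[n nW]; apply: filterS (near n) => c [/gamP[Gc cg] cn].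
rewrite -(mulVKg e c); apply: nW; exists (g^-1 * gam c).
  by split=> //; apply: GM => //; exact: GV.
by rewrite boundary_actM boundary_actV -cg.
Qed.

Lemma coset_compact a n : compact [set a * b | b in stab_nbhs n].
Proof.
have -> : [set a * b | b in stab_nbhs n] =
    [set a * b | b in stab_nbhs 0] `&` [set a * b | b in stab_nbhs n].
  apply/seteqP; split=> [c [b bn <-]|c []//]; split; last by exists b.
  exists b => //; case: bn => g [Gg _] bg; exists g => //; split=> // v /size0nil->.
  by rewrite treeAut0.
apply: compact_closedI; last exact: coset_closed.
apply: continuous_compact stab_nbhs0_compact.
apply: continuous_subspaceT => b W /AAut_nbhsP[m mW].
by apply/AAut_nbhsP; exists m => c cm; rewrite /= /preimage /= mulgA; exact: mW.
Qed.

Lemma AAut_tdlc : tdlc_group (AAut G).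
Proof.
split.
- exact: AAut_topological_group.
- exact: zero_dimensional_hausdorff AAut_zero_dimensional.
- exact: zero_dimension_totally_disconnected AAut_zero_dimensional.
move=> a _; exists [set a * b | b in stab_nbhs 0].
  apply/AAut_nbhsP; exists 0 => b b0 _; exists b => //.
by split; [exact: coset_compact|exact: coset_closed].
Qed.

End Topology.

(** * Bricks and pavings *)

Section Bricks.
Local Open Scope fset_scope.
Variables (d : nat) (G : selfSimilarGroup d).
Hypothesis d_gt1 : (1 < d)%N.
Local Notation bd := (boundary d).
Local Notation act := (@boundary_act d).
Implicit Types (k l : bd -> bd) (u v w : word d) (xi zeta : bd).
Implicit Types (a b s : AAut G) (x y : {fset set (bd -> bd)}).

Let G1 : ssgroup_set G 1 := subgroup1 (ssgroup_subgroup G).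
Let GM := subgroupM (ssgroup_subgroup G).
Let GV := subgroupV (ssgroup_subgroup G).

Let x0 : 'I_d := Ordinal (ltnW d_gt1).
Let xi0 : bd := fun=> x0.

Definition brick k : set (bd -> bd) :=
  [set l | exists2 g, ssgroup_set G g & l = k \o act g].

Lemma brick_refl k : brick k k.
Proof. by exists 1 => //; apply/funext => xi; rewrite boundary_act1. Qed.

Lemma brickP k l : brick k = brick l <-> brick l k.
Proof.
split=> [<-|[g Gg ->]]; first exact: brick_refl.
apply/seteqP; split=> _ [h Gh ->].
  by exists (g * h); [exact: GM|rewrite boundary_actM].
exists (g^-1 * h); first exact/GM/Gh/GV.
by apply/funext => xi; rewrite !boundary_actM /= (boundary_invK g).
Qed.

Lemma brick_comp k l (f : bd -> bd) :
  brick k = brick l -> brick (f \o k) = brick (f \o l).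
Proof. by move=> /brickP[g Gg ->]; apply/brickP; exists g. Qed.

(** If [k = l \o act g], then [k \o bcat u] is [l \o bcat (g u)] composed with the section of [g] at
    [u], which is again in [G]. *)
Lemma brick_sub k l : brick k = brick l -> exists g : treeAut d,
  forall u, brick (k \o bcat u) = brick (l \o bcat (g u)).
Proof.
move=> /brickP[g Gg ->]; exists g => u; apply/brickP.
exists (section g u); first exact: ssgroup_self_similar.
by apply/funext => xi; rewrite /comp boundary_act_bcat.
Qed.

Lemma comp_bcat k u v : k \o bcat (u ++ v) = (k \o bcat u) \o bcat v.
Proof. by apply/funext => xi /=; rewrite bcat_cat. Qed.

Lemma act_surj (g : treeAut d) xi : exists zeta, act g zeta = xi.
Proof. by exists (act g^-1 xi); exact: boundary_invK. Qed.

Definition supp (p : set (bd -> bd)) : set bd :=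
  [set xi | exists2 k, p k & range k xi].

Lemma supp_brick k : supp (brick k) = range k.
Proof.
apply/seteqP; split=> [_ [_ [g _ ->] [xi _ <-]]|xi kxi].
  by exists (act g xi).
by exists k => //; exact: brick_refl.
Qed.

Definition local_map k n := forall v, size v = n ->
  exists w, exists2 g, ssgroup_set G g &
    forall xi, k (bcat v xi) = bcat w (act g xi).

Definition embedding k := injective k /\ exists n, local_map k n.

Lemma local_map_leq k m n : (m <= n)%N -> local_map k m -> local_map k n.
Proof.
move=> mn km v vn; have vm : size (take m v) = m by rewrite size_takel // vn.
have [w [g Gg kg]] := km _ vm; exists (w ++ g (drop m v)), (section g (drop m v)).
  exact: ssgroup_self_similar.
move=> xi; rewrite -{1}(cat_take_drop m v) bcat_cat kg boundary_act_bcat.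
by rewrite bcat_cat.
Qed.

Lemma AAut_inj a : injective a. Proof. exact: can_inj (perm_funK a). Qed.

Lemma AAut_local a : exists n, local_map a n.
Proof. exact: almost_automorphism_local (AAutP a). Qed.

Lemma embedding_AAut a : embedding a.
Proof. by split; [exact: AAut_inj|exact: AAut_local]. Qed.

Lemma embedding_bcat k u : embedding k -> embedding (k \o bcat u).
Proof.
move=> [kinj [n kn]]; split; first exact: inj_comp (@bcat_inj _ u).
exists n => v vn.
have [|w [g Gg kg]] := local_map_leq (leq_addl (size u) n) kn (v := u ++ v).
  by rewrite size_cat vn.
by exists w, g => // xi; rewrite /= -bcat_cat kg.
Qed.

(** Merges [d] charts into one whose children they are. *)
Definition glue (f : 'I_d -> bd -> bd) : bd -> bd :=
  fun xi => f (xi 0) (fun n => xi n.+1).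

Lemma bcat1_split xi : xi = bcat [:: xi 0] (fun n => xi n.+1).
Proof. exact: (bcat_split 1 xi). Qed.

Lemma glue_bcat f i : glue f \o bcat [:: i] = f i.
Proof.
apply/funext => xi; rewrite /glue /comp.
have -> : (fun n => bcat [:: i] xi n.+1) = xi.
  by apply/funext => n; rewrite /bcat /= nth_nil subSS subn0.
by [].
Qed.

Lemma embedding_glue f : (forall i, embedding (f i)) ->
  (forall i j xi zeta, f i xi = f j zeta -> i = j) -> embedding (glue f).
Proof.
move=> fe fdisj; split.
  move=> xi zeta E; have E0 := fdisj _ _ _ _ E.
  rewrite [xi]bcat1_split [zeta]bcat1_split E0; congr bcat.
  by move: E; rewrite /glue E0 => /(fe _).1.
have /choice[n nP] i : exists n, local_map (f i) n by case: (fe i).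
(* One level for the letter that selects [f i], then a common level of locality. *)
exists (\max_i n i).+1 => -[//|i v] [vn].
have [|w [g Gg fg]] := @local_map_leq _ _ _ (leq_bigmax i) (nP i) v.
  by rewrite vn.
by exists w, g => // xi; rewrite -fg -(glue_bcat f i) -cat1s bcat_cat.
Qed.

Lemma AAut_of_bijective_embedding k : embedding k -> (forall xi, range k xi) ->
  exists a, AAut_perm a = k :> (bd -> bd).
Proof.
move=> [kinj [n kn]] ksurj.
have /choice[k' k'K] xi : exists zeta, k zeta = xi.
  by have [zeta _ <-] := ksurj xi; exists zeta.
have kK : cancel k k' by move=> xi; apply: kinj; rewrite k'K.
have Gk : almost_automorphism G (Permutation kK k'K).
  by apply: (@local_almost_automorphism _ _ _ n) => v /kn[w kw]; exists w.
by exists (MkAAut Gk).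
Qed.

(** * Carets and their contraction *)

Definition child k i : set (bd -> bd) := brick (k \o bcat [:: i]).
Definition children k : {fset set (bd -> bd)} := [fset child k i | i in 'I_d].

Lemma childrenP k p : reflect (exists i, p = child k i) (p \in children k).
Proof.
apply: (iffP idP) => [/imfsetP[i _ ->]|[i ->]]; first by exists i.
by apply/imfsetP; exists i.
Qed.

Lemma child_in k i : child k i \in children k.
Proof. by apply/childrenP; exists i. Qed.

Lemma brick_children k l : brick k = brick l -> children k = children l.
Proof.
have sub k' l' : brick k' = brick l' -> children k' `<=` children l'.
  move=> /brick_sub[g E]; apply/fsubsetP => p /childrenP[i ->].
  by rewrite /child E level1E; exact: child_in.
by move=> E; apply/eqP; rewrite eqEfsubset !sub.
Qed.

Lemma supp_child k i xi : supp (child k i) xi -> range k xi.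
Proof. by rewrite supp_brick => -[{}xi _ <-]; exists (bcat [:: i] xi). Qed.

Lemma supp_children k xi : range k xi -> exists i, supp (child k i) xi.
Proof.
move=> [zeta _ <-]; exists (zeta 0); rewrite supp_brick.
by exists (fun n => zeta n.+1) => //=; rewrite -bcat1_split.
Qed.

Lemma bcat1_inj i j xi zeta : bcat [:: i] xi = bcat [:: j] zeta -> i = j.
Proof. by move=> /bcat_take/= /(_ isT)[]. Qed.

Lemma child_disjoint k i j xi : injective k ->
  supp (child k i) xi -> supp (child k j) xi -> i = j.
Proof.
move=> kinj; rewrite !supp_brick => -[z _ <-] [z' _ /kinj].
by move=> /bcat1_inj.
Qed.

Lemma supp_brick_neq0 k : exists xi, supp (brick k) xi.
Proof. by rewrite supp_brick; exists (k xi0), xi0. Qed.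

Lemma card_children k : injective k -> #|` children k| = d.
Proof.
move=> kinj; rewrite card_imfset; last first.
  move=> i j E; have [xi kxi] := supp_brick_neq0 (k \o bcat [:: i]).
  by apply: (child_disjoint kinj kxi); rewrite -E.
by rewrite -cardE card_ord.
Qed.

(* The bricks k o G are the cones of the boundary, each with a G-class of
   charts; a paving is a partition of the boundary into bricks that arises from
   the one-brick partition by expanding bricks into their children. *)
Definition paving x := [/\ forall p, p \in x -> exists2 k, embedding k & p = brick k,
  forall xi, exists2 p, p \in x & supp p xi,
  forall p q xi, p \in x -> q \in x -> supp p xi -> supp q xi -> p = q &
  exists n, #|` x| = (1 + n * d.-1)%N].

Definition caret x k := embedding k /\ children k `<=` x.

Definition reduce x k := brick k |` (x `\` children k).

Lemma mem_reduce x k p :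
  (p \in reduce x k) = (p == brick k) || (p \in x) && (p \notin children k).
Proof. by rewrite in_fset1U in_fsetD andbC. Qed.

(** [brick k] meets its child at [x0]; disjointness in [x] would make the two equal, but the
    children have been removed. *)
Lemma brick_notin_reduce x k : paving x -> caret x k ->
  brick k \notin x `\` children k.
Proof.
move=> [_ _ xdisj _] [[kinj _] kx]; apply/negP; rewrite in_fsetD => /andP[nk xk].
have [xi xixi] := supp_brick_neq0 (k \o bcat [:: x0]).
have E : brick k = child k x0.
  apply: (xdisj _ _ xi) => //; first by apply: (fsubsetP kx); exact: child_in.
  by rewrite supp_brick; exact: supp_child xixi.
by move: nk; rewrite E child_in.
Qed.

Lemma card_reduce x k : paving x -> caret x k -> (#|` reduce x k| + d.-1 = #|` x|)%N.
Proof.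
move=> px ck; rewrite cardfsU1 brick_notin_reduce // cardfsD.
have [[kinj _] kx] := ck; rewrite (fsetIidPr kx).
have := fsubset_leq_card kx; rewrite card_children //=; lia.
Qed.

Lemma paving_reduce x k : paving x -> caret x k -> paving (reduce x k).
Proof.
move=> px ck; have crd := card_reduce px ck.
have r0 : (0 < #|` reduce x k|)%N.
  by rewrite cardfs_gt0; apply/fset0Pn; exists (brick k); rewrite mem_reduce eqxx.
have [xe xcov xdisj [n xn]] := px; have [ke /fsubsetP kx] := ck.
have disj p xi : p \in x -> p \notin children k -> supp p xi -> range k xi -> False.
  move=> xp /negP np pxi /supp_children[i ixi]; apply: np.
  by rewrite (xdisj p (child k i) xi) // ?child_in //; apply: kx; exact: child_in.
split.
- by move=> p; rewrite mem_reduce => /orP[/eqP->|/andP[/xe]//]; exists k.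
- move=> xi; have [p xp pxi] := xcov xi.
  have [/childrenP[i E]|np] := boolP (p \in children k).
    exists (brick k); first by rewrite mem_reduce eqxx.
    by rewrite supp_brick; apply: (@supp_child k i); rewrite -E.
  by exists p => //; rewrite mem_reduce xp np orbT.
- move=> p q xi; rewrite !mem_reduce => /orP[/eqP->|/andP[xp np]].
    move=> /orP[/eqP->//|/andP[xq nq]]; rewrite supp_brick => kxi qxi.
    by case: (disj _ _ xq nq qxi kxi).
  move=> /orP[/eqP->|/andP[xq nq]]; last exact: xdisj.
  by rewrite supp_brick => pxi kxi; case: (disj _ _ xp np pxi kxi).
(* Contraction removes [d.-1] bricks; [n = 0] is excluded because [reduce x k] is nonempty and
   [1 < d]. *)
- exists n.-1; case: n xn => [|n] xn; last by move: xn; rewrite mulSn; lia.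
  by move: d_gt1; lia.
Qed.

Lemma caret_reduce x k l : caret x k -> caret x l ->
  [disjoint children k & children l] -> caret (reduce x k) l.
Proof.
move=> [_ _] [le lx] kl; split=> //; apply/fsubsetP => p lp.
rewrite mem_reduce (fsubsetP lx) //=; apply/orP; right.
by move: kl; rewrite fdisjoint_sym => /fdisjointP/(_ p lp).
Qed.

(* Any d bricks of a paving form a caret: they are the children of the brick
   obtained by gluing them. *)
Lemma exists_caret x y : paving x -> (#|` y| + d <= #|` x|)%N ->
  exists2 k, caret x k & [disjoint y & children k].
Proof.
move=> [xe xcov xdisj _] yx.
have dz : (d <= #|` x `\` y|)%N.
  have := cardfsD x y; have := fsubset_leq_card (fsubsetIr x y); lia.
set z := x `\` y in dz.
have /choice[f fP] (i : 'I_d) : exists k, embedding k /\ nth (brick id) z i = brick k.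
  have : nth (brick id) z i \in z by rewrite mem_nth // (leq_trans _ dz).
  by rewrite in_fsetD => /andP[_ /xe[k ke ->]]; exists k.
have zi (i : 'I_d) : brick (f i) \in z.
  by rewrite -(fP i).2 mem_nth // (leq_trans _ dz).
have zx p : p \in z -> p \in x by rewrite in_fsetD => /andP[].
have fdisj (i j : 'I_d) xi zeta : f i xi = f j zeta -> i = j.
  move=> E; have : brick (f i) = brick (f j).
    apply: (xdisj _ _ (f i xi)); [exact/zx/zi|exact/zx/zi| |].
      by rewrite supp_brick; exists xi.
    by rewrite supp_brick E; exists zeta.
  rewrite -!(fP _).2 => /eqP; rewrite nth_uniq ?fset_uniq ?(leq_trans _ dz) //.
  by move=> /eqP/val_inj.
have chE i : child (glue f) i = brick (f i) by rewrite /child glue_bcat.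
exists (glue f).
  split; first by apply: embedding_glue => // i; case: (fP i).
  by apply/fsubsetP => p /childrenP[i ->]; rewrite chE; exact/zx/zi.
rewrite fdisjoint_sym; apply/fdisjointP => p /childrenP[i ->].
by rewrite chE; have := zi i; rewrite in_fsetD => /andP[].
Qed.

(** * Cones of an almost automorphism and the pavings it fits *)

Definition cone a v : set (bd -> bd) := brick (a \o bcat v).

Lemma bcat_prefix u v xi zeta : bcat u xi = bcat v zeta ->
  (size u <= size v)%N -> prefix u v.
Proof. by move=> E uv; rewrite prefixE -(bcat_take E uv). Qed.

Lemma other_letter (i : 'I_d) : exists j, j != i.
Proof.
have [E|] := eqVneq i x0; last by exists x0; rewrite eq_sym.
by exists (Ordinal d_gt1); rewrite E.
Qed.

Lemma range_bcat_prefix u v :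
  (forall xi, exists zeta, bcat u xi = bcat v zeta) -> prefix v u.
Proof.
move=> uv; have [vu|ltuv] := leqP (size v) (size u).
  by have [zeta /esym E] := uv xi0; exact: bcat_prefix E vu.
(* If [v] is longer, continuing [u] by a letter other than the next one of [v] leaves the cone of
   [v]. *)
have [j] := other_letter (nth x0 v (size u)); have [zeta] := uv (bcat [:: j] xi0).
rewrite -bcat_cat => /bcat_take; rewrite size_cat addn1 => /(_ ltuv).
rewrite cats1 (take_nth x0) // => /rcons_inj[_ ->].
by rewrite eqxx.
Qed.

Lemma cone_inj a : injective (cone a).
Proof.
have pre u v : cone a u = cone a v -> prefix v u.
  move=> /esym/brickP[g _ E]; apply: range_bcat_prefix => xi.
  have [zeta <-] := act_surj g xi; exists zeta; apply/(@AAut_inj a).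
  exact: (esym (congr1 (fun f : bd -> bd => f zeta) E)).
move=> u v E; have := pre _ _ E; have := pre _ _ (esym E).
move=> /prefixP[s ->] /prefixP[t]; rewrite -catA => /(congr1 size).
by case: s => [|? ?]; rewrite ?cats0 // !size_cat /=; lia.
Qed.

Lemma cone_comparable a u v xi : supp (cone a u) xi -> supp (cone a v) xi ->
  prefix u v \/ prefix v u.
Proof.
rewrite !supp_brick => -[z _ <-] [z' _ /AAut_inj E].
have [le|/ltnW le] := leqP (size u) (size v); [left|right].
  exact: bcat_prefix (esym E) le.
exact: bcat_prefix E le.
Qed.

Definition fits a x := forall p, p \in x -> exists v, p = cone a v.
Definition below a k := exists v, brick k = cone a v.

(** If the contracted brick is the cone of [a] at [v], then its children are the cones at the
    children of [v], permuted by an element of [G]; the remaining bricks are common to both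
    pavings. *)
Lemma fits_reduce a x k : caret x k ->
  fits a (reduce x k) <-> fits a x /\ below a k.
Proof.
move=> [_ kx]; split=> [ar|[ax ak] p]; last first.
  by rewrite mem_reduce => /orP[/eqP->|/andP[/ax]].
have [v E] : below a k by apply: ar; rewrite mem_reduce eqxx.
split=> [p xp|]; last by exists v.
have [/childrenP[i ->]|np] := boolP (p \in children k).
  have [g Eg] := brick_sub E.
  by exists (v ++ g [:: i]); rewrite /child Eg /cone comp_bcat.
by apply: ar; rewrite mem_reduce xp np orbT.
Qed.

(** Carets are contracted until one brick is left. Its chart is a bijection of the boundary, hence
    an almost automorphism. *)
Lemma paving_fits x : paving x -> exists a, fits a x.
Proof.
have [n] := ubnP #|` x|; elim: n x => // n IH x; rewrite ltnS => xn px.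
have [xe xcov _ [[|m] xm]] := px; last first.
  have [|k ck _] := @exists_caret x fset0 px.
    by rewrite cardfs0 xm mulSn; move: d_gt1; lia.
  have [||a /fits_reduce[//|ax _]] := IH (reduce x k).
  - by have := card_reduce px ck; move: d_gt1; lia.
  - exact: paving_reduce.
  by exists a.
move: xm; rewrite mul0n addn0 => /eqP/cardfs1P[p xp].
have [k ke pk] : exists2 k, embedding k & p = brick k.
  by apply: xe; rewrite xp in_fset1.
have [a ak] : exists a, AAut_perm a = k :> (bd -> bd).
  apply: AAut_of_bijective_embedding => // xi; have [q] := xcov xi.
  by rewrite xp in_fset1 => /eqP->; rewrite pk supp_brick.
exists a => q; rewrite xp in_fset1 => /eqP->; exists [::].
by rewrite pk -ak /cone; congr brick; apply/funext => xi /=; rewrite bcat0.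
Qed.

(** A common child is a cone of [a], and its word has only one parent. *)
Lemma below_carets a k l : below a k -> below a l ->
  brick k = brick l \/ [disjoint children k & children l].
Proof.
move=> [v kv] [w lw].
have [dkl|] := boolP [disjoint children k & children l]%fset; first by right.
rewrite -fsetI_eq0 => /fset0Pn[p]; rewrite in_fsetI.
rewrite (brick_children kv) (brick_children lw).
move=> /andP[/childrenP[i ->] /childrenP[j]].
rewrite /child -!comp_bcat !cats1 => /cone_inj/rcons_inj[vw _].
by left; rewrite kv lw vw.
Qed.

End Bricks.

(** * Lifting the elements that fit a paving *)

Section Lifting.
Local Open Scope fset_scope.
Variables (d : nat) (G : selfSimilarGroup d).
Hypothesis d_gt1 : (1 < d)%N.
Local Notation bd := (boundary d).
Implicit Types (k l : bd -> bd) (u v w : word d) (xi zeta : bd).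
Implicit Types (a b c s : AAut G) (x y : {fset set (bd -> bd)}).
Implicit Types (T : {fset word d}).

Let x0 : 'I_d := Ordinal (ltnW d_gt1).
Let xi0 : bd := fun=> x0.

(** * Prefix codes and the generating set *)

Definition prefix_code T :=
  (forall xi, exists2 u, u \in T & exists zeta, xi = bcat u zeta) /\
  (forall u v, u \in T -> v \in T -> prefix u v -> u = v).

(* Five carets use up at most 5 d bricks, which leaves d bricks for another one. *)
Definition size_bound := (6 * d)%N.

(** An intrinsic form of the quotients [a^-1 * b], suited to compactness: [T] holds the words of the
    paving seen from [b], and [T'] those seen from [a]. *)
Definition generators : set (AAut G) := [set s | exists T T',
  [/\ prefix_code T, prefix_code T', (#|` T| <= size_bound)%N, (#|` T'| <= size_bound)%N &
      forall u, u \in T -> exists2 v, v \in T' & cone s u = brick G (bcat v)]].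

Lemma supp_cone_prefix a u v xi :
  prefix u v -> supp (cone a v) xi -> supp (cone a u) xi.
Proof.
move=> /prefixP[t ->]; rewrite !supp_brick => -[z _ <-].
by exists (bcat t z) => //=; rewrite bcat_cat.
Qed.

Lemma supp_coneE a v xi : supp (cone a v) (a (bcat v xi)).
Proof. by rewrite supp_brick; exists xi. Qed.

Lemma fits_prefix x a u v : paving G x -> cone a u \in x -> cone a v \in x ->
  prefix u v -> u = v.
Proof.
move=> [_ _ xdisj _] xu xv uv; apply: (cone_inj d_gt1 (a := a)).
apply: (xdisj _ _ (a (bcat v xi0))) => //; last exact: supp_coneE.
exact/(supp_cone_prefix uv)/supp_coneE.
Qed.

(** By counting, some brick of [x] is the cone of [a] at a word strictly below a word [u] of [T]; a
    deepest such brick and its siblings form a caret. *)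
Lemma fits_caret x a T : paving G x -> fits a x -> prefix_code T -> (#|` T| < #|` x|)%N ->
  exists2 u, u \in T & exists w, caret G x (a \o bcat (u ++ w)).
Proof.
move=> px ax [Tcov _] Tx; have [_ xcov xdisj _] := px.
have /choice[w wP] p : exists v, p \in x -> p = cone a v.
  by have [/ax[v ->]|] := boolP (p \in x); [exists v|exists [::]].
have xw p : p \in x -> cone a (w p) \in x by move=> xp; rewrite -wP.
have winj p q : p \in x -> q \in x -> prefix (w p) (w q) -> p = q.
  move=> xp xq /(fits_prefix px (xw _ xp) (xw _ xq)) E.
  by rewrite [LHS]wP // [RHS]wP // E.
pose inner u p := (p \in x) && prefix u (w p) && (u != w p).
have [u Tu [p up]] : exists2 u, u \in T & exists p, inner u p.
  (* Otherwise each [w p] is a prefix of some [t p] in [T], and [t] is injective because bricks are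
     disjoint, against the cardinalities. *)
  apply: contrapT => no.
  have /choice[t tP] p : exists u, p \in x -> u \in T /\ prefix (w p) u.
    have [xp|] := boolP (p \in x); last by exists [::].
    have [u Tu [zeta E]] := Tcov (bcat (w p) xi0); exists u => _; split=> //.
    have [le|/ltnW le] := leqP (size (w p)) (size u).
      exact: bcat_prefix E le.
    have up := bcat_prefix (esym E) le.
    have [->|nup] := eqVneq u (w p); first exact: prefix_refl.
    by case: no; exists u => //; exists p; rewrite /inner xp up.
  have tinj : {in x &, injective t}.
    move=> p q xp xq E; have [_ pt] := tP p xp; have [_ qt] := tP q xq.
    apply: (xdisj _ _ (a (bcat (t p) xi0))) => //.
      by rewrite [X in supp X](wP p xp); apply: (supp_cone_prefix pt); exact: supp_coneE.
    by rewrite [X in supp X](wP q xq) E; apply: (supp_cone_prefix qt); exact: supp_coneE.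
  move: Tx; rewrite ltnNge -(card_in_imfset imfset_key tinj) fsubset_leq_card //.
  by apply/fsubsetP => _ /imfsetP[p xp ->]; case: (tP p xp).
have xp : p \in x by case/andP: up => /andP[].
pose P (q : x) := inner u (val q).
have Pp : P [` xp] by [].
case: (arg_maxnP (fun q : x => size (w (val q))) Pp) => q.
rewrite /P /inner => /andP[/andP[xq uq] nuq] qmax.
have {qmax} qmax r : inner u r -> (size (w r) <= size (w (val q)))%N.
  by move=> ur; case/andP: (ur) => /andP[xr _] _; exact: (qmax [` xr]).
case/lastP E: (w (val q)) uq nuq => [|w1 i] uq nuq.
  by move: uq nuq; rewrite prefixs0 => /eqP->; rewrite eqxx.
have [t w1E] : exists t, w1 = u ++ t.
  move: uq nuq => /prefixP[t]; case/lastP: t => [|t j].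
    by rewrite cats0 => ->; rewrite eqxx.
  by rewrite -rcons_cat => /rcons_inj[-> _]; exists t.
exists u => //; exists t; split; first exact: embedding_bcat (embedding_AAut a).
apply/fsubsetP => _ /childrenP[j ->]; rewrite -w1E /child -comp_bcat cats1.
(* [r] is the brick at a point of the sibling cone. A [w r] longer than the sibling contradicts
   maximality; a shorter one would be a prefix of [w (val q)]. *)
have [r xr] := xcov (a (bcat (rcons w1 j) xi0)); rewrite {1}(wP r xr) => rs.
have [jr|rj] := cone_comparable (supp_coneE a (rcons w1 j) xi0) rs.
  suff -> : rcons w1 j = w r by exact: xw.
  have ur : inner u r.
    rewrite /inner xr (prefix_trans _ jr) /=; last first.
      by rewrite w1E rcons_cat prefix_prefix.
    apply/eqP => ur; have := size_prefix jr; rewrite -ur w1E.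
    by rewrite size_rcons size_cat; lia.
  have := qmax r ur; rewrite E size_rcons.
  by move: jr => /prefixP[[|? ?] ->]; rewrite ?cats0 // size_cat size_rcons /=; lia.
have [<-|nrj] := eqVneq (w r) (rcons w1 j); first exact: xw.
have rq : prefix (w r) (w (val q)).
  rewrite E; move: rj nrj => /prefixP[t']; case/lastP: t' => [|t' j'].
    by rewrite cats0 => ->; rewrite eqxx.
  rewrite -rcons_cat => /rcons_inj[w1r _] _.
  by rewrite -cats1 w1r -catA prefix_prefix.
move: nrj; have rqE := winj _ _ xr xq rq; move: rj; rewrite rqE E.
move=> /prefixP[[|? ?] rE]; first by rewrite rE cats0 eqxx.
by move: rE => /(congr1 size); rewrite size_cat !size_rcons /=; lia.
Qed.

Lemma fits_prefix_code x a (w : set (bd -> bd) -> word d) : paving G x -> fits a x ->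
  (forall p, p \in x -> p = cone a (w p)) -> prefix_code [fset w p | p in x].
Proof.
move=> px ax wP; have [_ xcov _ _] := px.
have xw p : p \in x -> cone a (w p) \in x by move=> xp; rewrite -wP.
split=> [xi|u v /imfsetP[/= p xp ->] /imfsetP[/= q xq ->]].
  have [p xp] := xcov (a xi); rewrite (wP p xp) supp_brick => -[z _ /AAut_inj E].
  by exists (w p); [apply/imfsetP; exists p|exists z].
by apply: (fits_prefix px); exact: xw.
Qed.

Lemma generators_of_paving x a b : paving G x -> (#|` x| <= size_bound)%N ->
  fits a x -> fits b x -> generators (a^-1 * b).
Proof.
move=> px xsmall ax bx.
have ex c : fits c x -> exists w : set (bd -> bd) -> word d,
    forall p, p \in x -> p = cone c (w p).
  move=> cx; have /choice[w wP] p : exists v, p \in x -> p = cone c v.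
    by have [/cx[v ->]|] := boolP (p \in x); [exists v|exists [::]].
  by exists w.
have [wa waP] := ex a ax; have [wb wbP] := ex b bx.
exists [fset wb p | p in x], [fset wa p | p in x]; split.
- exact: fits_prefix_code bx wbP.
- exact: fits_prefix_code ax waP.
- by apply: leq_trans xsmall; exact: leq_imfset_card.
- by apply: leq_trans xsmall; exact: leq_imfset_card.
move=> _ /imfsetP[/= p xp ->]; exists (wa p); first by apply/imfsetP; exists p.
have : cone b (wb p) = cone a (wa p) by rewrite -wbP // -waP.
move=> /(brick_comp (perm_inv a)) E.
rewrite -[RHS](_ : brick G (perm_inv a \o (a \o bcat (wa p))) = _).
  by rewrite -E.
by congr brick; apply/funext => xi /=; rewrite perm_funK.
Qed.

Lemma prefix_code_nil : prefix_code [fset [::]].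
Proof.
split=> [xi|u v]; last by rewrite !in_fset1 => /eqP-> /eqP->.
by exists [::]; [rewrite in_fset1|exists xi; rewrite bcat0].
Qed.

Lemma size_bound_gt1 : (1 < size_bound)%N.
Proof. by move: d_gt1; rewrite /size_bound; lia. Qed.

Lemma fits_below x a : paving G x -> fits a x -> (1 < #|` x|)%N ->
  exists2 k, caret G x k & below a k.
Proof.
move=> px ax x_gt1; have [|u _ [w ck]] := fits_caret px ax prefix_code_nil.
  by rewrite cardfs1.
by exists (a \o bcat (u ++ w)) => //; exists (u ++ w).
Qed.

(** Every edge from [a] to [a * s] survives a contraction: [T] has fewer words than [x] has bricks,
    so [a * s] has a caret below a word of [T], and [s] carries that cone to a cone, so the caret is
    also below [a]. *)
Lemma generators_below x a s : paving G x -> generators s -> fits a x -> fits (a * s) x ->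
  (size_bound < #|` x|)%N -> exists k, [/\ caret G x k, below a k & below (a * s) k].
Proof.
move=> px [T [T' [cT _ Tsmall _ sT]]] ax asx xbig.
have [|u Tu [w ck]] := fits_caret px asx cT; first exact: leq_ltn_trans xbig.
exists ((a * s) \o bcat (u ++ w)); split=> //; last by exists (u ++ w).
have [v _ E] := sT u Tu.
have /brick_sub[g Eg] : cone (a * s) u = cone a v by exact: (brick_comp a E).
by exists (v ++ g w); rewrite /cone !comp_bcat -Eg.
Qed.

(** Disjoint carets can be contracted in succession, and some element fits the resulting paving. *)
Lemma carets2_fits x k l : paving G x -> caret G x k -> caret G x l ->
  [disjoint children G k & children G l] ->
  exists c, [/\ fits c x, below c k & below c l].
Proof.
move=> px ck cl kl; have crl := caret_reduce ck cl kl.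
have [c] := paving_fits d_gt1 (paving_reduce d_gt1 (paving_reduce d_gt1 px ck) crl).
by move=> /(fits_reduce _ crl)[/(fits_reduce _ ck)[cx bk] bl]; exists c.
Qed.

Lemma carets3_fits x k l m : paving G x ->
  caret G x k -> caret G x l -> caret G x m ->
  [disjoint children G k & children G l] ->
  [disjoint children G k & children G m] ->
  [disjoint children G l & children G m] ->
  exists c, [/\ fits c x, below c k, below c l & below c m].
Proof.
move=> px ck cl cm kl km lm; have crl := caret_reduce ck cl kl.
have crm := caret_reduce ck cm km.
have [c []] := carets2_fits (paving_reduce d_gt1 px ck) crl crm lm.
by move=> /(fits_reduce _ ck)[cx bk] bl bm; exists c.
Qed.

Lemma exists_disjoint_caret x (s : seq (bd -> bd)) : paving G x -> (size_bound < #|` x|)%N ->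
  (size s <= 5)%N -> (forall k, k \in s -> caret G x k) ->
  exists2 l, caret G x l &
    forall k, k \in s -> [disjoint children G k & children G l].
Proof.
move=> px xbig s5 sx; pose y := \bigcup_(k <- s) children G k.
have ycard : (#|` y| <= size s * d)%N.
  rewrite /y; elim: s sx {s5 y} => [|k s IH] sx; first by rewrite big_nil cardfs0.
  rewrite big_cons mulSn (leq_trans (leq_card_fsetU _ _)) // leq_add //.
    have [|[kinj _] _] := sx k; first by rewrite inE eqxx.
    by rewrite card_children.
  by apply: IH => l sl; apply: sx; rewrite inE sl orbT.
have [|l cl yl] := exists_caret d_gt1 (y := y) px.
  have : (size s * d <= 5 * d)%N by rewrite leq_mul2r s5 orbT.
  by move: xbig ycard; rewrite /size_bound; lia.
exists l => // k ks; apply: fdisjointWl yl; rewrite /y.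
exact: bigfcup_sup.
Qed.

(** The elements that fit [x] are connected by generators, stated as propagation of a property [E].
    In a small paving [a^-1 * b] is itself a generator. *)
Lemma paving_connected x (E : set (AAut G)) : paving G x ->
  (forall a s, generators s -> fits a x -> fits (a * s) x -> E a -> E (a * s)) ->
  forall a b, fits a x -> fits b x -> E a -> E b.
Proof.
have [n] := ubnP #|` x|; elim: n x => // n IH x; rewrite ltnS => xn px Ex a b ax bx Ea.
have [xsmall|xbig] := leqP #|` x| size_bound.
  by rewrite -(mulVKg a b); apply: Ex => //; rewrite ?mulVKg //; exact: (generators_of_paving px).
have x_gt1 := ltn_trans size_bound_gt1 xbig.
have {}IH k c c' : caret G x k -> fits c x -> below c k -> fits c' x ->
    below c' k -> E c -> E c'.
  move=> ck cx bck c'x bc'k; apply: (IH (reduce G x k)).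
  - by have := card_reduce d_gt1 px ck; move: d_gt1; lia.
  - exact: paving_reduce.
  - by move=> e s Gs /(fits_reduce _ ck)[ex _] /(fits_reduce _ ck)[esx _]; exact: Ex.
  - exact/fits_reduce.
  - exact/fits_reduce.
(* The path from [a] to [b] runs through the contractions of [k], [m] and [l] in turn; consecutive
   ones share an element because [m] is disjoint from [k] and [l]. *)
have [k ck ak] := fits_below px ax x_gt1; have [l cl bl] := fits_below px bx x_gt1.
have [||m cm dm] := @exists_disjoint_caret x [:: k; l] px xbig.
- by [].
- by move=> e; rewrite !inE => /orP[/eqP->|/eqP->].
have km : [disjoint children G k & children G m]%fset by apply: dm; rewrite inE eqxx.
have lm : [disjoint children G l & children G m]%fset by apply: dm; rewrite !inE eqxx orbT.
have [c [cx bck bcm]] := carets2_fits px ck cm km.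
have [e [ex bel bem]] := carets2_fits px cl cm lm.
apply: (IH l e) => //; apply: (IH m c) => //; exact: (IH k a).
Qed.

(** * Uniqueness and existence of lifts *)

Section Lift.
Variables (P : groupType) (j : AAut G -> P).
Hypothesis jM : forall s t, generators s -> generators t -> generators (s * t) ->
  j (s * t) = j s * j t.

(** Continuation of [j] along the edges of the Cayley graph between elements that fit [x]; other
    values are arbitrary. *)
Definition Cayley_lift x (f : AAut G -> P) := forall a s, generators s ->
  fits a x -> fits (a * s) x -> f (a * s) = f a * j s.

Lemma Cayley_lift_unique x f g a b : paving G x -> Cayley_lift x f -> Cayley_lift x g ->
  fits a x -> fits b x -> f a = g a -> f b = g b.
Proof.
move=> px fx gx ax bx E; apply: (@paving_connected x [set c | f c = g c] px _ a b) => //=.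
by move=> c s Gs cx csx cE; rewrite fx // gx // cE.
Qed.

Lemma Cayley_lift_mull x f p : Cayley_lift x f -> Cayley_lift x (fun a => p * f a).
Proof. by move=> fx a s Gs ax asx; rewrite fx // mulgA. Qed.

(** The common domain is the set of elements that fit the paving contracted at both carets; it is
    connected, so agreement at [c] spreads. *)
Lemma Cayley_lift_agree x k l f g c : paving G x -> caret G x k -> caret G x l ->
  [disjoint children G k & children G l] ->
  Cayley_lift (reduce G x k) f -> Cayley_lift (reduce G x l) g ->
  fits c x -> below c k -> below c l -> f c = g c ->
  forall b, fits b x -> below b k -> below b l -> f b = g b.
Proof.
move=> px ck cl kl fk gl cx bck bcl E b bx bbk bbl.
have crl := caret_reduce ck cl kl.
have both (e : AAut G) : fits e x -> below e k -> below e l -> fits e (reduce G (reduce G x k) l).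
  by move=> ex bek bel; apply/(fits_reduce _ crl); split=> //; exact/(fits_reduce _ ck).
have sub (e : AAut G) : fits e (reduce G (reduce G x k) l) ->
    fits e (reduce G x k) /\ fits e (reduce G x l).
  move=> /(fits_reduce _ crl)[ek el]; split=> //.
  by apply/(fits_reduce _ cl); split=> //; case/(fits_reduce _ ck): ek.
apply: (@Cayley_lift_unique (reduce G (reduce G x k) l) f g c).
- exact/paving_reduce/crl/paving_reduce.
- by move=> e s Gs /sub[ek _] /sub[esk _]; exact: fk.
- by move=> e s Gs /sub[_ el] /sub[_ esl]; exact: gl.
- exact: both.
- exact: both.
- exact: E.
Qed.

(** This is where simple connectedness enters: lifts over the contracted pavings are normalised by
    continuation from one base caret, shown to be independent of the route, and glued. *)
Lemma exists_Cayley_lift x : paving G x -> exists f, Cayley_lift x f.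
Proof.
have [n] := ubnP #|` x|; elim: n x => // n IH x; rewrite ltnS => xn px.
have [xsmall|xbig] := leqP #|` x| size_bound.
  (* All quotients of elements that fit a small paving are generators, so [jM] applies directly. *)
  have [c cx] := paving_fits d_gt1 px; exists (fun a => j (c^-1 * a)).
  move=> a s Gs ax asx; rewrite mulgA jM // -?mulgA; exact: (generators_of_paving px).
have x_gt1 := ltn_trans size_bound_gt1 xbig.
have {}IH k : caret G x k -> exists f, Cayley_lift (reduce G x k) f.
  move=> ck; apply: IH; last exact: paving_reduce.
  by have := card_reduce d_gt1 px ck; move: d_gt1; lia.
have [c0 c0x] := paving_fits d_gt1 px.
have [k0 ck0 _] := fits_below px c0x x_gt1; have [F0 F0lift] := IH k0 ck0.
(* Left translation makes any lift over [l] agree with [f] at one common element. *)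
have meet k l f : caret G x k -> caret G x l ->
    [disjoint children G k & children G l]%fset -> exists g c,
    [/\ Cayley_lift (reduce G x l) g, fits c x, below c k, below c l & f c = g c].
  move=> ck cl kl; have [g glift] := IH l cl.
  have [c [cx bck bcl]] := carets2_fits px ck cl kl.
  exists (fun a => (f c * (g c)^-1) * g a), c; split=> //.
    exact: Cayley_lift_mull.
  by rewrite mulgVK.
(* f is obtained from F0 by continuation through a caret e disjoint from k0, k. *)
pose linked k f := [/\ caret G x k, Cayley_lift (reduce G x k) f &
  exists e g, [/\ caret G x e, Cayley_lift (reduce G x e) g,
    [disjoint children G k0 & children G e]%fset,
    [disjoint children G k & children G e]%fset &
    (exists c, [/\ fits c x, below c k0, below c e & F0 c = g c]) /\
    (exists c, [/\ fits c x, below c k, below c e & f c = g c])]].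
have linkedE k : caret G x k -> exists f, linked k f.
  move=> ck; have [||e ce dis] := @exists_disjoint_caret x [:: k0; k] px xbig.
  - by [].
  - by move=> l; rewrite !inE => /orP[/eqP->|/eqP->].
  have k0e : [disjoint children G k0 & children G e]%fset by apply: dis; rewrite inE eqxx.
  have ke : [disjoint children G k & children G e]%fset by apply: dis; rewrite !inE eqxx orbT.
  have [g [c [glift cx bck bce E]]] := meet k0 e F0 ck0 ce k0e.
  have ek : [disjoint children G e & children G k]%fset by rewrite fdisjoint_sym.
  have [f [c' [flift c'x bc'e bc'k E']]] := meet e k g ce ck ek.
  exists f; split=> //; exists e, g; split=> //; split; first by exists c.
  by exists c'.
(* Independence of the route. The five carets [k0], [k], [l], [e] and [m] must be avoided at once,
   whence the factor in [size_bound]. *)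
have linked_agree k l f g b : linked k f -> linked l g ->
    brick G k = brick G l \/ [disjoint children G k & children G l]%fset ->
    fits b x -> below b k -> below b l -> f b = g b.
  move=> [ck fk [e [f' [ce f'e k0e ke [[c [cx bck0 bce Ec]] [c' [c'x bc'k bc'e Ec']]]]]]].
  move=> [cl gl [m [g' [cm g'm k0m lm [[h [hx bhk0 bhm Eh]] [h' [h'x bh'l bh'm Eh']]]]]]].
  move=> kl bx bbk bbl.
  (* All continuations agree with the one through o. *)
  have [||o co dis] := @exists_disjoint_caret x [:: k0; k; l; e; m] px xbig.
  - by [].
  - by move=> i; rewrite !inE => /or4P[/eqP->|/eqP->|/eqP->|/orP[/eqP->|/eqP->]].
  have k0o : [disjoint children G k0 & children G o]%fset by apply: dis; rewrite !inE eqxx.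
  have ko : [disjoint children G k & children G o]%fset by apply: dis; rewrite !inE eqxx ?orbT.
  have lo : [disjoint children G l & children G o]%fset by apply: dis; rewrite !inE eqxx ?orbT.
  have eo : [disjoint children G e & children G o]%fset by apply: dis; rewrite !inE eqxx ?orbT.
  have mo : [disjoint children G m & children G o]%fset by apply: dis; rewrite !inE eqxx ?orbT.
  have [L [z [Lo zx bzk0 bzo Ez]]] := meet k0 o F0 ck0 co k0o.
  (* First [f2] agrees with [L], by comparing both with [F0] at an element below [k0], [e'] and [o];
     then [f1] agrees with [L], by comparing both with [f2] at an element below [k'], [e'] and
     [o]. *)
  have agreeL k' f1 e' f2 c1 c2 : caret G x k' -> caret G x e' ->
      Cayley_lift (reduce G x k') f1 -> Cayley_lift (reduce G x e') f2 ->
      [disjoint children G k0 & children G e']%fset ->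
      [disjoint children G k' & children G e']%fset ->
      [disjoint children G k' & children G o]%fset ->
      [disjoint children G e' & children G o]%fset ->
      fits c1 x -> below c1 k0 -> below c1 e' -> F0 c1 = f2 c1 ->
      fits c2 x -> below c2 k' -> below c2 e' -> f1 c2 = f2 c2 ->
      forall q, fits q x -> below q k' -> below q o -> f1 q = L q.
    move=> ck' ce' f1k' f2e' k0e' k'e' k'o e'o c1x c1k0 c1e' E1 c2x c2k' c2e' E2.
    have [p [px' pk0 pe' po]] := carets3_fits px ck0 ce' co k0e' k0o e'o.
    have E3 : f2 p = L p.
      rewrite -(Cayley_lift_agree px ck0 ce' k0e' F0lift f2e' c1x c1k0 c1e' E1 px' pk0 pe').
      exact: (Cayley_lift_agree px ck0 co k0o F0lift Lo zx bzk0 bzo Ez).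
    have [q [qx qk' qe' qo]] := carets3_fits px ck' ce' co k'e' k'o e'o.
    apply: (Cayley_lift_agree px ck' co k'o f1k' Lo qx qk' qo).
    rewrite (Cayley_lift_agree px ck' ce' k'e' f1k' f2e' c2x c2k' c2e' E2) //.
    exact: (Cayley_lift_agree px ce' co e'o f2e' Lo px' pe' po E3).
  have fL := agreeL k f e f' c c' ck ce fk f'e k0e ke ko eo cx bck0 bce Ec c'x bc'k bc'e Ec'.
  have gL := agreeL l g m g' h h' cl cm gl g'm k0m lm lo mo hx bhk0 bhm Eh h'x bh'l bh'm Eh'.
  (* In either case both lifts equal [L] at some [q], and agreement spreads from there. *)
  case: kl => [klE|kl].
    have [q [qx bqk bqo]] := carets2_fits px ck co ko.
    have bql : below q l by case: bqk => v; rewrite klE; exists v.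
    have rE : reduce G x k = reduce G x l by rewrite /reduce klE (brick_children klE).
    apply: (@Cayley_lift_unique (reduce G x k) f g q).
    + exact: paving_reduce.
    + by [].
    + by rewrite rE.
    + exact/(fits_reduce _ ck).
    + exact/(fits_reduce _ ck).
    + by rewrite fL // gL.
  have [q [qx bqk bql bqo]] := carets3_fits px ck cl co kl ko lo.
  apply: (Cayley_lift_agree px ck cl kl fk gl qx bqk bql) => //.
  by rewrite fL // gL.
have /choice[F FP] a : exists p, fits a x ->
    exists k f, [/\ linked k f, below a k & p = f a].
  have [ax|] := pselect (fits a x); last by exists 1.
  have [k ck ak] := fits_below px ax x_gt1; have [f kf] := linkedE k ck.
  by exists (f a) => _; exists k, f.
have FE a k f : linked k f -> fits a x -> below a k -> F a = f a.
  move=> kf ax ak; have [l [g [lg al ->]]] := FP a ax.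
  exact: (linked_agree l k g f a lg kf (below_carets d_gt1 al ak)).
(* The whole edge lies over a single caret [k], where [F] coincides with one lift. *)
exists F => a s Gs ax asx; have [k [ck ak ask]] := generators_below px Gs ax asx xbig.
have [f kf] := linkedE k ck; rewrite !(FE _ k f) //.
by case: kf => _ fk _; apply: fk => //; exact/(fits_reduce _ ck).
Qed.

End Lift.

End Lifting.

(** * The presentation *)

Section LevelPaving.
Local Open Scope fset_scope.
Variables (d : nat) (G : selfSimilarGroup d).
Hypothesis d_gt1 : (1 < d)%N.
Local Notation bd := (boundary d).
Implicit Types (a b s : AAut G).

Definition level_paving n : {fset set (bd -> bd)} :=
  [fset brick G (bcat (tval t)) | t in {: n.-tuple 'I_d}].

Lemma level_pavingP n p : reflect (exists2 v : word d, size v = n & p = brick G (bcat v))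
  (p \in level_paving n).
Proof.
apply: (iffP idP) => [/imfsetP[t _ ->]|[v vn ->]].
  by exists (tval t) => //; exact: size_tuple.
by apply/imfsetP; exists (Tuple (introT eqP vn)).
Qed.

Lemma brick_bcat v : brick G (bcat v) = cone (1 : AAut G) v.
Proof. by []. Qed.

Lemma paving_level n : paving G (level_paving n).
Proof.
have inj v w : brick G (bcat v) = brick G (bcat w) -> v = w.
  by rewrite !brick_bcat => /(cone_inj d_gt1).
split.
- move=> _ /level_pavingP[v _ ->]; exists (bcat v) => //.
  exact: (@embedding_bcat _ G _ v (embedding_AAut 1)).
- move=> xi; exists (brick G (bcat (mkseq xi n))).
    by apply/level_pavingP; exists (mkseq xi n); rewrite ?size_mkseq.
  by rewrite supp_brick; exists (fun i => xi (n + i)%N); rewrite // -bcat_split.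
- move=> _ _ xi /level_pavingP[v vn ->] /level_pavingP[w wn ->].
  rewrite !supp_brick => -[z _ <-] [z' _ /bcat_take].
  by rewrite vn wn leqnn => /(_ isT); rewrite take_oversize ?vn // => ->.
rewrite card_imfset; last by move=> t t' /inj/val_inj.
rewrite -cardE card_tuple card_ord.
(* The count is [d ^ n], and [d (1 + m (d - 1)) = 1 + (1 + d m) (d - 1)]. *)
elim: n => [|n [m E]]; first by exists 0.
exists (1 + d * m)%N; rewrite expnS E; move: d_gt1; nia.
Qed.

(** From a level of locality of [a^-1] on, the cone at [v] is the image under [a] of a cone at some
    [w]. *)
Lemma fits_level a : exists n, forall m, (n <= m)%N -> fits a (level_paving m).
Proof.
have [n an] := AAut_local a^-1; exists n => m nm p /level_pavingP[v vm ->].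
have [w [g Gg aE]] := local_map_leq nm an vm.
exists w; apply/brickP; exists g => //; apply/funext => xi /=.
rewrite -[LHS](perm_invK a); congr (a _).
exact: aE.
Qed.

Lemma fits_level_seq (r : seq (AAut G)) :
  exists n, forall a, a \in r -> fits a (level_paving n).
Proof.
suff [n nP] : exists n, forall m a, (n <= m)%N -> a \in r -> fits a (level_paving m).
  by exists n => a; exact: nP.
elim: r => [|a r [n IH]]; first by exists 0.
have [n' IH'] := fits_level a; exists (maxn n n') => m b.
rewrite geq_max inE => /andP[nm n'm] /orP[/eqP->|]; first exact: IH'.
exact: IH.
Qed.

End LevelPaving.

(** * Sufficiency of the relators of length at most three *)

Section Presentation.
Local Open Scope fset_scope.
Variables (d : nat) (G : selfSimilarGroup d).
Hypothesis d_gt1 : (1 < d)%N.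
Local Notation S := (@generators d G).

Definition short_relators : set (gen_word S) :=
  [set r | (size r <= 3)%N /\ gen_eval r = 1].

(** 1 and [a] fit a common level, and [paving_connected] joins them by generators. *)
Lemma generated_generators : generated S = [set: AAut G].
Proof.
apply/seteqP; split=> // a _ E [Esub SE].
have [n nP] := fits_level_seq [:: 1; a].
apply: (@paving_connected _ _ d_gt1 _ E (paving_level G d_gt1 n) _ 1 a).
- by move=> b s Ss _ _ Eb; apply: subgroupM => //; exact: SE.
- by apply: nP; rewrite inE eqxx.
- by apply: nP; rewrite !inE eqxx orbT.
- exact: subgroup1.
Qed.

Lemma gen_eval_cat (u v : gen_word S) :
  gen_eval (u ++ v) = gen_eval u * gen_eval v.
Proof. by rewrite /gen_eval big_cat. Qed.

Lemma presented_gen_eval (w w' : gen_word S) :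
  presented_eq short_relators w w' -> gen_eval w = gen_eval w'.
Proof.
elim=> // [{}w {}w' w'' _ -> _ ->//|u v x e|u v r [_ r1]].
  rewrite !gen_eval_cat; congr (_ * _).
  rewrite /gen_eval !big_cons big_nil mulg1 /=.
  by case: e; rewrite /= ?mulVg ?mulgV mul1g.
by rewrite !gen_eval_cat r1 mul1g.
Qed.

Local Notation P := (presented_group short_relators).

(** Made total, with value 1 off [S], because lifting takes a map on all of [AAut G]. *)
Definition gen_image (a : AAut G) : P :=
  if pselect (S a) is left Sa
  then presented_gen short_relators (exist _ a (mem_set Sa)) else 1.

Lemma gen_imageE (s : S) : gen_image (val s) = presented_gen short_relators s.
Proof.
rewrite /gen_image; case: pselect => [Sa|]; last by case; apply: set_mem; case: s.
by congr presented_gen; exact: val_inj.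
Qed.

(** Read off the relator [(s t)^-1 s t], of length three. *)
Lemma gen_imageM s t : S s -> S t -> S (s * t) ->
  gen_image (s * t) = gen_image s * gen_image t.
Proof.
move=> Ss St Sst.
pose s' : S := exist _ s (mem_set Ss).
pose t' : S := exist _ t (mem_set St).
pose st' : S := exist _ (s * t) (mem_set Sst).
rewrite -[s]/(val s') -[t]/(val t') -[val s' * _]/(val st') !gen_imageE.
have : word_eval (presented_gen short_relators)
    [:: (st', true); (s', false); (t', false)] = 1.
  rewrite word_eval_presented; apply/presented_piP.
  rewrite -[X in presented_eq _ X]cats0 -[X in presented_eq _ X]cat0s.
  apply: presented_relator; split=> //.
  by rewrite /gen_eval !big_cons big_nil /= mulg1 mulVg.
rewrite /word_eval !big_cons big_nil /letter_eval /= mulg1.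
by move=> E; rewrite -[RHS](mulVKg (presented_gen short_relators st')) E mulg1.
Qed.

(** All partial products of both words fit one level. A lift [f] there sends the end of each path
    from 1 to [f 1] times the class of its word, so equal ends give equal classes. *)
Lemma presentation_generators : presentation short_relators.
Proof.
split; first exact: generated_generators.
move=> w w'; split=> [E|]; last exact: presented_gen_eval.
pose r (u : gen_word S) := [seq gen_eval (take i u) | i <- iota 0 (size u).+1].
have [n nP] := fits_level_seq (r w ++ r w').
have px := paving_level G d_gt1 n.
have [f fx] := exists_Cayley_lift d_gt1 gen_imageM px.
have step (u : gen_word S) :
    (forall i, (i <= size u)%N -> fits (gen_eval (take i u)) (level_paving G n)) ->
    f (gen_eval u) = f 1 * word_eval (presented_gen short_relators) u.
  elim/last_ind: u => [|u [s e] IH] ux.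
    by rewrite /gen_eval /word_eval !big_nil mulg1.
  have uE i : (i <= size u)%N -> take i (rcons u (s, e)) = take i u.
    by move=> iu; rewrite -cats1 takel_cat.
  have ux' i : (i <= size u)%N -> fits (gen_eval (take i u)) (level_paving G n).
    by move=> iu; rewrite -uE //; apply: ux; rewrite size_rcons leqW.
  have fu : fits (gen_eval u) (level_paving G n).
    by rewrite -[u]take_size; exact: ux'.
  have fus : fits (gen_eval (rcons u (s, e))) (level_paving G n).
    by rewrite -[rcons _ _]take_size; exact: ux.
  have evalE : gen_eval (rcons u (s, e)) =
      gen_eval u * (if e then (val s)^-1 else val s).
    by rewrite -cats1 gen_eval_cat /gen_eval big_cons big_nil mulg1.
  have Ss : S (val s) by apply: set_mem; case: (s).
  rewrite /word_eval -cats1 big_cat -/(word_eval _ _) big_cons big_nil /= mulg1.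
  rewrite cats1 mulgA -IH // /letter_eval /= -gen_imageE.
  move: fus; rewrite evalE; case: e {ux uE evalE} => fus; last exact: fx.
  (* An inverse letter is an edge read backwards, ending at [gen_eval u]. *)
  have := fx (gen_eval u * (val s)^-1) (val s) Ss fus.
  rewrite mulgVK => /(_ fu) ->.
  by rewrite mulgK.
apply/presented_piP; rewrite -!word_eval_presented.
apply: (mulgI (f 1)); rewrite -!step ?E // => i iw; apply: nP; rewrite mem_cat.
  by apply/orP; right; apply/mapP; exists i; rewrite // mem_iota.
by apply/orP; left; apply/mapP; exists i; rewrite // mem_iota.
Qed.

End Presentation.

(** * Compactness of the generating set *)

Section CompactGenerators.
Local Open Scope fset_scope.
Variables (d : nat) (G : selfSimilarGroup d) (n0 : nat).
Hypothesis d_gt1 : (1 < d)%N.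
Hypothesis Gbranch : branching G n0.
Hypothesis Gclosed : closed (ssgroup_set G).
Local Notation bd := (boundary d).
Local Notation L := (size_bound d).
Implicit Types (u v w : word d) (T : {fset word d}) (s a b : AAut G).

Let x0 : 'I_d := Ordinal (ltnW d_gt1).
Let xi0 : bd := fun=> x0.
Let GM := subgroupM (ssgroup_subgroup G).
Let GV := subgroupV (ssgroup_subgroup G).

(* Each of the proper prefixes of u branches off at least one further word. *)
Lemma prefix_code_size T u : prefix_code T -> u \in T -> (size u <= #|` T|)%N.
Proof.
move=> [Tcov Tanti] Tu.
have /choice[o oP] (i : 'I_d) := other_letter d_gt1 i.
pose z i := rcons (take i u) (o (nth x0 u i)).
have zsize i : (i < size u)%N -> size (z i) = i.+1.
  by move=> iu; rewrite size_rcons size_takel // ltnW.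
have /choice[t tP] (i : 'I_(size u)) : exists v, v \in T /\ prefix (z i) v.
  have [v Tv [zeta E]] := Tcov (bcat (z i) xi0); exists v; split=> //.
  have [le|lt] := leqP (size (z i)) (size v); first exact: bcat_prefix E le.
  have vu : v = u.
    apply: Tanti => //; apply: (prefix_trans _ (prefix_take u i)).
    have := bcat_prefix (esym E) (ltnW lt) => /prefixP[r].
    case/lastP: r => [|r c]; first by rewrite cats0 => zv; rewrite zv ltnn in lt.
    by rewrite -rcons_cat => /rcons_inj[-> _]; exact: prefix_prefix.
  by move: lt; rewrite vu zsize // ltnS leqNgt ltn_ord.
have tinj : injective t.
  suff tlt (i j : 'I_(size u)) : (i < j)%N -> t i != t j.
    move=> i j /eqP E; apply/eqP; move: E; apply: contraLR.
    rewrite -val_eqE neq_ltn => /orP[/tlt//|/tlt].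
    by rewrite eq_sym.
  (* At place [i] the word [z j] still follows [u] while [z i] has left it, so they have no common
     extension. *)
  move=> ij; apply/eqP => E.
  have [_ /prefixP[a tiE]] := tP i; have [_ /prefixP[b tjE]] := tP j.
  have := congr1 (fun r => nth x0 r i) (etrans (esym tiE) (etrans E tjE)).
  rewrite /z !nth_cat !nth_rcons !size_rcons !size_takel ?(ltnW (ltn_ord _)) //.
  rewrite ltnS leqnn ltnn eqxx (ltn_trans ij (leqnn _)) ij nth_take // => oE.
  by have := oP (nth x0 u i); rewrite oE eqxx.
rewrite -{1}(card_ord (size u)) cardE -(size_map t) uniq_leq_size //.
  by rewrite map_inj_uniq // enum_uniq.
by move=> _ /mapP[i _ ->]; case: (tP i).
Qed.

Lemma prefix_code_prefix T v : prefix_code T -> (#|` T| <= size v)%N ->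
  exists2 u, u \in T & prefix u v.
Proof.
move=> cT Tv; have [u Tu [zeta E]] := cT.1 (bcat v xi0); exists u => //.
apply: bcat_prefix (esym E) _; exact: leq_trans (prefix_code_size cT Tu) Tv.
Qed.

(** Right multiplication by [g] in [G] replaces the code [T] by its image under [g^-1]. *)
Lemma generators_stab_nbhs s b : generators s -> stab_nbhs 0 b -> generators (s * b).
Proof.
move=> [T [T' [[Tcov Tanti] cT' Tsmall T'size_bound sT]]] [g [Gg _] bg].
exists [fset g^-1 u | u in T], T'; split=> //.
- split=> [xi|_ _ /imfsetP[/= u Tu ->] /imfsetP[/= v Tv ->] /prefixP[r vE]].
    have [u Tu [zeta E]] := Tcov (boundary_act g xi).
    exists (g^-1 u); first by apply/imfsetP; exists u.
    exists (boundary_act (section g^-1 u) zeta).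
    by rewrite -boundary_act_bcat -E boundary_actV; exact/esym/perm_funK.
  congr (_ _); apply: Tanti => //; have /(congr1 g) := vE.
  by rewrite section_cat !treeAutKV => ->; exact: prefix_prefix.
- by apply: leq_trans Tsmall; exact: leq_imfset_card.
move=> _ /imfsetP[/= u Tu ->]; have [v T'v E] := sT u Tu; exists v => //.
rewrite -E; apply/brickP; exists (section g (g^-1 u)); first exact: ssgroup_self_similar.
apply/funext => xi; transitivity (s (boundary_act g (bcat (g^-1 u) xi))).
  by rewrite -bg.
by rewrite boundary_act_bcat treeAutKV.
Qed.

(** A finite record of [s]: its images of the cones of level [L], with the charts remembered only
    through their action on level [n0]. *)
Definition action_data s (f : word d -> word d) := forall v, size v = L ->
  exists w, exists2 g, ssgroup_set G g &
    (forall xi, s (bcat v xi) = bcat w (boundary_act g xi)) /\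
    (forall r, size r = n0 -> f (v ++ r) = w ++ g r).

(** Codes with at most [L] words have words of length at most [L], so [s] is local on level [L]; the
    bound on image lengths leaves finitely many records. *)
Lemma generators_action_data s : generators s -> exists f, action_data s f /\
  forall v, (size v <= L + n0)%N -> (size (f v) <= L + (L + n0))%N.
Proof.
move=> [T [T' [cT cT' Tsmall T'size_bound sT]]].
have /choice[wg wgP] v : exists wg : word d * treeAut d, size v = L ->
    [/\ ssgroup_set G wg.2, (size wg.1 <= L + L)%N &
    forall xi, s (bcat v xi) = bcat wg.1 (boundary_act wg.2 xi)].
  have [vL|] := pselect (size v = L); last by exists ([::], 1).
  have [|u Tu /prefixP[r vE]] := @prefix_code_prefix T v cT; first by rewrite vL.
  have [w T'w /brickP[g Gg E]] := sT u Tu.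
  have {}E xi : s (bcat u xi) = bcat w (boundary_act g xi).
    exact: (congr1 (fun f : bd -> bd => f xi) E).
  exists (w ++ g r, section g r) => _; split.
  - exact: ssgroup_self_similar.
  - rewrite size_cat treeAut_size leq_add //.
      exact: leq_trans (prefix_code_size cT' T'w) T'size_bound.
    by rewrite -vL vE size_cat leq_addl.
  - by move=> xi; rewrite vE bcat_cat E boundary_act_bcat bcat_cat.
exists (fun v => if size (take L v) == L then
  (wg (take L v)).1 ++ (wg (take L v)).2 (drop L v) else [::]); split.
  move=> v vL; have [Gg _ sE] := wgP v vL; exists (wg v).1, (wg v).2 => //.
  by split=> // r rn; rewrite take_size_cat // vL eqxx drop_size_cat.
move=> v vL; case: eqP => // tL; have [_ wL _] := wgP _ tL.
by rewrite size_cat treeAut_size size_drop; move: vL wL; lia.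
Qed.

(** With equal records, [s^-1 * s'] fixes level [L] and its sections there lie in [G] and fix level
    [n0], so branching puts it in [G]. *)
Lemma action_data_coset s s' f f' : action_data s f -> action_data s' f' ->
  (forall v, size v = (L + n0)%N -> f v = f' v) -> stab_nbhs 0 (s^-1 * s').
Proof.
move=> sf sf' ff'.
have /choice[h hP] v : exists h : treeAut d, size v = L ->
    [/\ ssgroup_set G h, level_stab n0 h &
     forall xi, s' (bcat v xi) = s (bcat v (boundary_act h xi))].
  have [vL|] := pselect (size v = L); last by exists 1.
  have [w [g Gg [sE fE]]] := sf v vL; have [w' [g' Gg' [s'E f'E]]] := sf' v vL.
  have E r : size r = n0 -> w ++ g r = w' ++ g' r.
    by move=> rn; rewrite -fE // -f'E // ff' // size_cat vL rn.
  have ww' : w = w'.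
    have := E (nseq n0 x0); rewrite size_nseq => /(_ erefl) En.
    have sww' : size w = size w'.
      by have := congr1 size En; rewrite !size_cat !treeAut_size; lia.
    by move: En => /eqP; rewrite eqseq_cat // => /andP[/eqP].
  exists (g^-1 * g') => _; split.
  - by apply: GM => //; exact: GV.
  - apply/level_stab_eq => r rn; have := E r rn; rewrite ww' => /eqP.
    by rewrite eqseq_cat // => /andP[_ /eqP].
  - move=> xi; rewrite s'E sE ww' boundary_actM boundary_actV; congr bcat.
    exact/esym/(perm_invK (boundary_act g)).
exists (spread L h).
  split; last by move=> v /size0nil ->; rewrite treeAut0.
  apply: (Gbranch (n := L)) => [v|v vL]; first exact: spread_fix.
  by have [] := hP v vL; rewrite section_spread.
apply: permutation_ext => xi; rewrite (bcat_split L xi).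
rewrite spread_act ?size_mkseq //; apply: (can_inj (perm_funK s)).
have [_ _ <-] : [/\ _, _ & _] := hP (mkseq xi L) (size_mkseq _ _).
exact: perm_invK.
Qed.

(** The generating set is a union of left cosets of [G], one for each record that occurs, hence a
    finite union of compact sets. *)
Lemma generators_compact : compact (@generators d G).
Proof.
pose D := fset_set [set v : word d | (size v <= L + (L + n0))%N].
have DP v : (v \in D) = (size v <= L + (L + n0))%N.
  by rewrite in_fset_set ?mem_setE //; exact: finite_words_leq.
pose tab := {ffun (L + n0).-tuple 'I_d -> D}.
pose has s (phi : tab) := generators s /\ exists f, action_data s f /\
  forall t : (L + n0).-tuple 'I_d, f t = val (phi t).
have tabE s : generators s -> exists phi, has s phi.
  move=> Ss; have [f [sf fsize]] := generators_action_data Ss.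
  have fD (t : (L + n0).-tuple 'I_d) : f t \in D by rewrite DP fsize // size_tuple.
  exists [ffun t => [` fD t]]; split=> //; exists f; split=> // t.
  by rewrite ffunE.
have /choice[rep repP] phi : exists s, (exists s', has s' phi) -> has s phi.
  have [[s sphi]|] := pselect (exists s, has s phi); first by exists s.
  by exists 1.
have -> : @generators d G =
    (\bigcup_(phi in [set` [pred phi : tab | `[< exists s, has s phi >]]])
    [set rep phi * b | b in stab_nbhs 0])%classic.
  apply/seteqP; split=> [s Ss|_ [phi /asboolP/repP[rS _] [b b0 <-]]].
    have [phi sphi] := tabE s Ss; have ephi : exists s, has s phi by exists s.
    exists phi; first exact/asboolP.
    have [_ [f [rf fE]]] := repP phi ephi; have [_ [f' [sf' f'E]]] := sphi.
    exists ((rep phi)^-1 * s); last by rewrite mulVKg.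
    apply: (action_data_coset rf sf') => v vn.
    by have := fE (Tuple (introT eqP vn)); rewrite -f'E.
  exact: generators_stab_nbhs.
rewrite bigcup_pred; apply: bigsetU_compact => phi _; exact: coset_compact.
Qed.

End CompactGenerators.

Theorem theorem1p4 (d : nat) (H : selfSimilarGroup d) :
  (2 <= d)%N ->
  finitely_generated (ssgroup_set H) ->
  contracting H ->
  (exists K : set (treeAut d),
     congruence_subgroup H K /\ regular_branch_over H K) ->
  tdlc_group (AAut (closure_group H)) /\
  compactly_presented (AAut (closure_group H)).
Proof.
move=> d_gt1 _ _ [K [congK branchK]].
have [n0 Gbranch] := branching_closure branchK congK.
have Gclosed : closed (ssgroup_set (closure_group H)) by exact: closed_closure.
split; first exact: (@AAut_tdlc d (closure_group H) n0 Gbranch Gclosed).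
exists (@generators d (closure_group H)), (@short_relators d (closure_group H)).
split; last by exists 3 => r [].
  exact: (@generators_compact d (closure_group H) n0 d_gt1 Gbranch Gclosed).
exact: presentation_generators.
Qed.
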